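(* Let $\Phi$ be the Knizhnik–Zamolodchikov associator in the variables $A_0,A_1$. Then $$\log(\Phi)=\sum_{n\ge 1}\ \sum_{\substack{(a_1,\dots,a_n)\in\{0,1\}^n\ \text{admissible}\\ (i_1,\dots,i_n)\in\{0,1\}^n}}\omega_{a_1,\dots,a_n}\,C^{a_1,\dots,a_n}_{i_1,\dots,i_n}\,\mathrm{CBH}_n(A_{i_n},\dots,A_{i_1}).$$
   Context: Let $A_0,A_1$ be noncommutative variables, $F_2$ the free associative (unital) algebra over $\mathbb C$ generated by $A_0,A_1$, and $\mathfrak f_2\subset F_2$ the (free) Lie subalgebra generated by $A_0,A_1$. $\widehat F_2$ and $\widehat{\mathfrak f}_2$ are the degree completions ($A_0,A_1$ have degree $1$). **The KZ associator.** Consider the differential equation $$G'(z)=\Big(\frac{A_0}{z}+\frac{A_1}{z-1}\Big)G(z)$$ on $]0,1[$, for $G\in\widehat F_2\,\widehat\otimes\,\mathcal O_{]0,1[}$, where $\mathcal O_{]0,1[}$ is the ring of analytic functions on $]0,1[$ and $\widehat F_2\,\widehat\otimes\, V$ is the completion of $F_2\otimes V$ with respect to the topology defined by the $F_2^{\ge n}\otimes V$ ($F_2^{\ge n}$ is the part of $F_2$ of degree $\ge n$); in other words, $G$ is a formal series in noncommutative words in $A_0,A_1$ with coefficients analytic functions on $]0,1[$. Let $G_0,G_1$ be the solutions with $G_0(z)\sim z^{A_0}$ as $z\to0^+$ and $G_1(z)\sim(1-z)^{A_1}$ as $z\to1^-$ (meaning that $G_0(z)z^{-A_0}\to1$ and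 $G_1(z)(1-z)^{-A_1}\to1$ respectively, coefficientwise, where $z^{A_0}=e^{\log(z)A_0}$ and $(1-z)^{A_1}=e^{\log(1-z)A_1}$). The KZ associator is the renormalized holonomy from $0$ to $1$ of this equation, i.e. the constant element $\Phi=G_1(z)^{-1}G_0(z)\in\widehat F_2$. It is a group-like element of $\widehat F_2$ (for the coproduct for which $A_0,A_1$ are primitive), and $\log(\Phi)\in\widehat{\mathfrak f}_2$ is its logarithm. **The numbers $\omega$.** A sequence $(a_1,\dots,a_n)\in\{0,1\}^n$ is admissible if $a_1=1$ and $a_n=0$. For $(a_1,\dots,a_n)$ admissible, set $$\omega_{a_1,\dots,a_n}=\int_{0\le t_1\le\cdots\le t_n\le1}\omega_{a_1}(t_1)\wedge\cdots\wedge\omega_{a_n}(t_n),\qquad \omega_0(t)=\frac{dt}{t},\quad \omega_1(t)=\frac{dt}{t-1}.$$ (Up to sign these are multiple zeta values.) **The integers $C$.** For $(i_1,\dots,i_n)\in\{0,1\}^n$ and $(a_1,\dots,a_n)$ admissible, the integers $C^{a_1,\dots,a_n}_{i_1,\dots,i_n}$ are defined by the identity in $F_2$ $$\sum_{(i_1,\dots,i_n)\in\{0,1\}^n}C^{a_1,\dots,a_n}_{i_1,\dots,i_n}A_{i_n}\cdots A_{i_1}=\sum_{\substack{S\subset\{\alpha\,|\,a_\alpha=0\}\\ T\subset\{\beta\,|\,a_\beta=1\}}}(-1)^{\mathrm{card}(S)+\mathrm{card}(T)}A_1^{\mathrm{card}(T)}\,A(a_1,\dots,a_n)^{S,T}\,A_0^{\mathrm{card}(S)},$$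 where $A(a_1,\dots,a_n)^{S,T}=\prod_{\alpha\in\{1,\dots,n\}\setminus(S\cup T)}A_{a_\alpha}$, the product being taken in decreasing order of the $\alpha$'s (the largest $\alpha$ is leftmost). **The polynomials $\mathrm{CBH}_n$.** $\mathrm{CBH}_n(x_1,\dots,x_n)$ is the multilinear part in free noncommuting variables $x_1,\dots,x_n$ (the sum of the terms of degree exactly $1$ in each $x_j$) of $\log(e^{x_1}\cdots e^{x_n})$. It is a Lie polynomial, and $\mathrm{CBH}_n(A_{i_n},\dots,A_{i_1})\in\mathfrak f_2$ is its evaluation at $x_1=A_{i_n},\dots,x_n=A_{i_1}$. *)

(* Defs.v *)
From HB Require Import structures.
From mathcomp Require Import all_boot all_order all_algebra.
From mathcomp Require Import complex.
From mathcomp Require Import all_classical all_reals all_analysis.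

Set Implicit Arguments.
Unset Strict Implicit.
Unset Printing Implicit Defensive.

Import Order.TTheory GRing.Theory Num.Theory.
Import numFieldNormedType.Exports.

Local Open Scope classical_set_scope.
Local Open Scope ring_scope.
Local Open Scope complex_scope.

(* [ncseries T K]: the degree completion of the free associative algebra over
   [K] on the letters [T], every letter having degree 1. The value at the word
   [[:: x1; ...; xn]] is the coefficient of the monomial [x1 * ... * xn].
   A record, and not an alias of [seq T -> K], because function types already
   carry the pointwise product. *)
Record ncseries (T : Type) (K : Type) := NCSeries { nccoef :> seq T -> K }.

Lemma ncseriesP (T K : Type) (f g : ncseries T K) :
  (forall w, f w = g w) -> f = g.
Proof. by case: f g => f [g] /= fg; congr NCSeries; exact/funext. Qed.

HB.instance Definition _ (T K : Type) := gen_eqMixin (ncseries T K).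
HB.instance Definition _ (T K : Type) := gen_choiceMixin (ncseries T K).

Section NCSeriesRing.
Variables (T : eqType) (K : comNzRingType).
Implicit Types (f g h : ncseries T K) (w : seq T).

Let addnc f g : ncseries T K := NCSeries (fun w => f w + g w).
Let oppnc f : ncseries T K := NCSeries (fun w => - f w).
Let zeronc : ncseries T K := NCSeries (fun=> 0).

Fact addncA : associative addnc.
Proof. by move=> f g h; apply: ncseriesP => w /=; rewrite addrA. Qed.
Fact addncC : commutative addnc.
Proof. by move=> f g; apply: ncseriesP => w /=; rewrite addrC. Qed.
Fact add0nc : left_id zeronc addnc.
Proof. by move=> f; apply: ncseriesP => w /=; rewrite add0r. Qed.
Fact addNnc : left_inverse zeronc oppnc addnc.
Proof. by move=> f; apply: ncseriesP => w /=; rewrite addNr. Qed.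

HB.instance Definition _ :=
  GRing.isZmodule.Build (ncseries T K) addncA addncC add0nc addNnc.

Lemma nccoefD f g w : (f + g) w = f w + g w. Proof. by []. Qed.
Lemma nccoefN f w : (- f) w = - f w. Proof. by []. Qed.
Lemma nccoefB f g w : (f - g) w = f w - g w. Proof. by []. Qed.
Lemma nccoef0 w : (0 : ncseries T K) w = 0. Proof. by []. Qed.

Definition onenc : ncseries T K := NCSeries (fun w => (w == [::])%:R).

Definition mulnc f g : ncseries T K :=
  NCSeries (fun w => \sum_(k < (size w).+1) f (take k w) * g (drop k w)).

Let lder (x : T) f : ncseries T K := NCSeries (fun w => f (x :: w)).

Let mulnc_nil f g : mulnc f g [::] = f [::] * g [::].
Proof. by rewrite /= big_ord1. Qed.

Let mulnc_cons f g x w :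
  mulnc f g (x :: w) = f [::] * g (x :: w) + mulnc (lder x f) g w.
Proof. by rewrite /= big_ord_recl. Qed.

Let mulnc_scale (c : K) f g w :
  mulnc (NCSeries (fun v => c * f v)) g w = c * mulnc f g w.
Proof. by rewrite /= mulr_sumr; apply: eq_bigr => k _; rewrite mulrA. Qed.

Fact mulncDl : left_distributive mulnc +%R.
Proof.
move=> f g h; apply: ncseriesP => w /=; rewrite -big_split /=.
by apply: eq_bigr => k _; rewrite mulrDl.
Qed.

Fact mulncDr : right_distributive mulnc +%R.
Proof.
move=> f g h; apply: ncseriesP => w /=; rewrite -big_split /=.
by apply: eq_bigr => k _; rewrite mulrDr.
Qed.

Fact mulncA : associative mulnc.
Proof.
move=> f g h; apply: ncseriesP => w; elim: w f g h => [|x w IHw] f g h.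
  by rewrite !mulnc_nil mulrA.
rewrite !mulnc_cons IHw mulnc_nil mulrDr !mulrA -addrA; congr (_ + _).
have -> : lder x (mulnc f g) =
    NCSeries (fun v => f [::] * lder x g v) + mulnc (lder x f) g.
  by apply: ncseriesP => v; rewrite [LHS]mulnc_cons.
by rewrite mulncDl nccoefD mulnc_scale.
Qed.

Fact mul1nc : left_id onenc mulnc.
Proof.
move=> f; apply: ncseriesP => -[|x w]; first by rewrite mulnc_nil /= mul1r.
rewrite mulnc_cons /= mul1r big1 ?addr0 // => k _.
by rewrite mul0r.
Qed.

Fact mulnc1 : right_id onenc mulnc.
Proof.
move=> f; apply: ncseriesP => w; elim: w f => [|x w IHw] f.
  by rewrite mulnc_nil /= mulr1.
by rewrite mulnc_cons IHw /= mulr0 add0r.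
Qed.

Fact onenc_neq0 : onenc != 0.
Proof.
apply/eqP => /(congr1 (fun f : ncseries T K => f [::])) /= /eqP.
by rewrite oner_eq0.
Qed.

HB.instance Definition _ := GRing.Zmodule_isNzRing.Build (ncseries T K)
  mulncA mul1nc mulnc1 mulncDl mulncDr onenc_neq0.

Lemma nccoef1 w : (1 : ncseries T K) w = (w == [::])%:R. Proof. by []. Qed.

Lemma nccoefM f g w :
  (f * g) w = \sum_(k < (size w).+1) f (take k w) * g (drop k w).
Proof. by []. Qed.

Lemma nccoef_sum (I : Type) (r : seq I) (P : pred I) (F : I -> ncseries T K) w :
  (\sum_(i <- r | P i) F i) w = \sum_(i <- r | P i) F i w.
Proof. by elim/big_rec2: _ => // i _ g _ <-. Qed.

Definition scalenc (c : K) f : ncseries T K := NCSeries (fun w => c * f w).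

Fact scalencA a b f : scalenc a (scalenc b f) = scalenc (a * b) f.
Proof. by apply: ncseriesP => w /=; rewrite mulrA. Qed.
Fact scale1nc : left_id 1 scalenc.
Proof. by move=> f; apply: ncseriesP => w /=; rewrite mul1r. Qed.
Fact scalencDr : right_distributive scalenc +%R.
Proof. by move=> c f g; apply: ncseriesP => w /=; rewrite mulrDr. Qed.
Fact scalencDl f : {morph scalenc^~ f : a b / a + b}.
Proof. by move=> a b; apply: ncseriesP => w /=; rewrite mulrDl. Qed.

HB.instance Definition _ := GRing.Zmodule_isLmodule.Build K (ncseries T K)
  scalencA scale1nc scalencDr scalencDl.

Lemma nccoefZ c f w : (c *: f) w = c * f w. Proof. by []. Qed.

Fact scalencAl (c : K) f g : c *: (f * g) = (c *: f) * g.
Proof. by apply: ncseriesP => w; rewrite [RHS]mulnc_scale. Qed.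

Fact scalencAr (c : K) f g : c *: (f * g) = f * (c *: g).
Proof.
apply: ncseriesP => w; rewrite nccoefZ !nccoefM mulr_sumr.
by apply: eq_bigr => k _; rewrite nccoefZ mulrCA.
Qed.

HB.instance Definition _ :=
  GRing.Lmodule_isLalgebra.Build K (ncseries T K) scalencAl.
HB.instance Definition _ :=
  GRing.Lalgebra_isAlgebra.Build K (ncseries T K) scalencAr.

(* [f^-1] is the two-sided inverse of [f] when there is one, and [f] itself
   otherwise, as for every MathComp [unitRingType]. *)
Definition unitnc : pred (ncseries T K) :=
  fun f => `[< exists g, g * f = 1 /\ f * g = 1 >].

Definition invnc f : ncseries T K :=
  if pselect (exists g, g * f = 1 /\ f * g = 1) is left ex
  then projT1 (cid ex) else f.

Fact mulVnc : {in unitnc, left_inverse 1 invnc *%R}.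
Proof.
move=> f /asboolP uf; rewrite /invnc; case: pselect => // ex.
by case: cid => g [].
Qed.

Fact mulncV : {in unitnc, right_inverse 1 invnc *%R}.
Proof.
move=> f /asboolP uf; rewrite /invnc; case: pselect => // ex.
by case: cid => g [].
Qed.

Fact unitncP f g : g * f = 1 /\ f * g = 1 -> unitnc f.
Proof. by move=> fg; apply/asboolP; exists g. Qed.

Fact invnc_out : {in [predC unitnc], invnc =1 id}.
Proof.
by move=> f /asboolP uf; rewrite /invnc; case: pselect.
Qed.

HB.instance Definition _ := GRing.NzRing_hasMulInverse.Build (ncseries T K)
  mulVnc mulncV unitncP invnc_out.

Definition ncvar (x : T) : ncseries T K := NCSeries (fun w => (w == [:: x])%:R).

Lemma prod_ncvar (s w : seq T) : (\prod_(x <- s) ncvar x) w = (w == s)%:R.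
Proof.
elim: s w => [|x s IHs] w; first by rewrite big_nil.
rewrite big_cons; case: w => [|y w]; rewrite nccoefM.
  by rewrite big_ord1 /= mul0r.
rewrite big_ord_recl /= mul0r add0r big_ord_recl /= take0 drop0 IHs.
rewrite !eqseq_cons andbT big1 => [|k _].
  by rewrite addr0 -natrM mulnb.
case: w k => [|z w] [k lt_k] //=.
by rewrite eqseq_cons andbF mul0r.
Qed.

End NCSeriesRing.

Arguments ncvar {T K} x.

(* Convergence for the topology in which the series without terms of degree
   [< d] form a basis of neighbourhoods of 0. *)
Definition ncseries_cvg (T K : Type) (u : nat -> ncseries T K)
    (s : ncseries T K) : Prop :=
  forall d : nat, exists N0 : nat, forall N : nat, (N0 <= N)%N ->
  forall w : seq T, (size w < d)%N -> u N w = s w.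

Section ExpLog.
Variables (T : eqType) (K : numFieldType).

(* For [f] without constant term, [f ^+ k] has no term of degree [< k]: the
   coefficient of [w] in [\sum_k f ^+ k / k!] only involves [k <= size w].
   Likewise for the logarithm of a series with constant term 1. *)
Definition ncexp (f : ncseries T K) : ncseries T K :=
  NCSeries (fun w =>
    (\sum_(0 <= k < (size w).+1) (k`!%:R : K)^-1 *: f ^+ k) w).

Definition nclog (f : ncseries T K) : ncseries T K :=
  NCSeries (fun w =>
    (\sum_(1 <= k < (size w).+1)
       ((-1) ^+ k.+1 / k%:R : K) *: (f - 1) ^+ k) w).

End ExpLog.

Section CBH.
Variable K : numFieldType.

Definition multilinear_part (n : nat) (f : ncseries 'I_n K) :
    ncseries 'I_n K :=
  NCSeries (fun w => if [forall j : 'I_n, count_mem j w == 1%N] then f w else 0).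

Definition CBH (n : nat) : ncseries 'I_n K :=
  multilinear_part (nclog (\prod_(j < n) ncexp (ncvar j))).

(* Evaluation at [y] of the part of [P] of degree at most [d]. *)
Definition nceval (d n : nat) (P : ncseries 'I_n K) (A : algType K)
    (y : 'I_n -> A) : A :=
  \sum_(k < d.+1) \sum_(w : k.-tuple 'I_n) P w *: \prod_(j <- w) y j.

(* [CBH n] is homogeneous of degree [n]. *)
Definition CBH_eval (n : nat) (A : algType K) (y : 'I_n -> A) : A :=
  nceval n (CBH n) y.

End CBH.

(* The letters [A_0] and [A_1] are indexed by [false] and [true], and sequences
   in {0,1} are sequences of booleans. *)
Section Coefficients.
Variable n : nat.
Implicit Types a i : n.-tuple bool.

Local Notation A b := (ncvar b : ncseries bool int).

Definition C_word a (S T : {set 'I_n}) : ncseries bool int :=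
  \prod_(al <- rev (enum (~: (S :|: T)))) A (tnth a al).

Definition C_generating a : ncseries bool int :=
  \sum_(S : {set 'I_n} | S \subset [pred al | ~~ tnth a al])
  \sum_(T : {set 'I_n} | T \subset [pred be | tnth a be])
    (-1) ^+ (#|S| + #|T|) * (A true ^+ #|T| * C_word a S T * A false ^+ #|S|).

Definition C_coef a i : int := C_generating a (rev i).

(* The identity that defines the integers [C_coef a i]. *)
Lemma C_coefE a :
  \sum_(i : n.-tuple bool) C_coef a i *: \prod_(b <- rev i) A b =
  C_generating a.
Proof.
apply: ncseriesP => w; rewrite nccoef_sum.
under eq_bigr do rewrite nccoefZ prod_ncvar.
have [wn|wn] := eqVneq (size w) n.
  pose i0 : n.-tuple bool := Tuple (introT eqP (etrans (size_rev w) wn)).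
  rewrite (bigD1 i0) //= revK eqxx mulr1 big1 ?addr0; last first.
    move=> i; rewrite -val_eqE /= => ne; rewrite -[w]revK (can_eq revK).
    by rewrite eq_sym (negbTE ne) mulr0.
  by rewrite /C_coef /= revK.
rewrite big1 => [|i _]; last first.
  case: eqP => [wi|_]; last by rewrite mulr0.
  by rewrite wi size_rev size_tuple eqxx in wn.
rewrite nccoef_sum big1 // => S S0; rewrite nccoef_sum big1 // => T T1.
rewrite -signr_odd; set t := (X in _ * X).
suff t0 : t w = 0 by case: odd; rewrite ?mul1r // mulN1r nccoefN t0 oppr0.
have AX b k : A b ^+ k = \prod_(c <- nseq k b) A c.
  by rewrite big_nseq; elim: k => // k IHk; rewrite exprS IHk.
rewrite /t /C_word 2!AX -(big_map (tnth a) xpredT (fun b => A b)) -!big_cat.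
rewrite prod_ncvar; case: eqP => // wE; case/eqP: wn; rewrite wE.
rewrite !size_cat !size_nseq size_map size_rev -cardE.
have dST : #|S :&: T| = 0.
  apply/eqP; rewrite cards_eq0; apply/eqP/setP => x; rewrite !inE.
  apply/negP => /andP[/(fintype.subsetP S0)+ /(fintype.subsetP T1)].
  by rewrite !inE => /negbTE ->.
have := cardsC (S :|: T); rewrite cardsU dST subn0 card_ord => nE.
by rewrite -[RHS]nE -addnA addnC -addnA addnCA addnA addnAC.
Qed.

End Coefficients.

Definition admissible (a : seq bool) : bool :=
  (head false a == true) && (last true a == false).

Section Omega.
Variable R : realType.

(* The iterated Lebesgue integral over R^n, outermost variable first. *)
Fixpoint nfold_integral (n : nat) (F : seq R -> \bar R) : \bar R :=
  if n is n'.+1 then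
    (\int[lebesgue_measure]_(t in [set: R])
       nfold_integral n' (fun s => F (t :: s)))%E
  else F [::].

Definition form (b : bool) (t : R) : R := if b then (t - 1)^-1 else t^-1.

(* [path <=%R 0 (rcons t 1)] is [0 <= t_1 <= ... <= t_n <= 1]. For admissible
   [a] the integrand has constant sign and is integrable on the simplex, so the
   iterated integral is the n-dimensional one. *)
Definition omega (a : seq bool) : R :=
  fine (nfold_integral (size a) (fun t =>
    (if path <=%R 0 (rcons t 1) then \prod_(p <- zip a t) form p.1 p.2 else 0)%:E)).

End Omega.

Section KZ.
Variable R : realType.
Local Notation C := (R[i]).
Local Notation A b := (ncvar b : ncseries bool C).

(* [C^o] is [C] with its usual topology. *)
Definition analytic01 (f : R -> C) : Prop :=
  forall z0 : R, 0 < z0 < 1 -> exists c : nat -> C^o,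
    \forall z \near z0,
      series (fun k => c k * ((z - z0)%:C : C^o) ^+ k) @ \oo --> (f z : C^o).

Definition has_deriv (f : R -> C) (z : R) (l : C) : Prop :=
  ((h^-1)%:C * (f (z + h) - f z) : C^o) @[h --> (0 : R)^'] --> (l : C^o).

Definition KZ_solution (G : R -> ncseries bool C) : Prop :=
  (forall w, analytic01 (fun z => G z w)) /\
  (forall z : R, 0 < z < 1 -> forall w,
     has_deriv (fun t => G t w) z
       ((((z^-1)%:C *: A false + ((z - 1)^-1)%:C *: A true) * G z) w)).

Definition ncpow (x : R) (f : ncseries bool C) : ncseries bool C :=
  ncexp ((ln x)%:C *: f).

Definition asymp_at0 (G : R -> ncseries bool C) : Prop :=
  forall w, ((G z * ncpow z (- A false)) w : C^o) @[z --> (0 : R)^'+] -->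
            ((1 : ncseries bool C) w : C^o).

Definition asymp_at1 (G : R -> ncseries bool C) : Prop :=
  forall w, ((G z * ncpow (1 - z) (- A true)) w : C^o) @[z --> (1 : R)^'-] -->
            ((1 : ncseries bool C) w : C^o).

Definition is_KZ_associator (Phi : ncseries bool C) : Prop :=
  exists G0 G1 : R -> ncseries bool C,
    [/\ KZ_solution G0, asymp_at0 G0, KZ_solution G1, asymp_at1 G1 &
        forall z : R, 0 < z < 1 -> Phi = (G1 z)^-1 * G0 z].

End KZ.

(* Main.v *)
Require Import Defs.
From mathcomp Require Import all_boot all_order all_algebra.
From mathcomp Require Import complex.
From mathcomp Require Import all_classical all_reals all_analysis.
From mathcomp Require Import measurable_realfun.
From mathcomp Require Import zify ring lra.

(** Two facts carry the proof: [Phi] is group-like, that is, its coefficients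
    form a character of the shuffle algebra, and its coefficients at the two
    letters vanish.

    The logarithm. For a group-like [f], the coefficient of [f ^+ k] at [w] is a
    sum of products of coefficients of [f] over the ways to cut [w] into [k]
    pieces; by the shuffle relations it is a linear combination of coefficients
    of [f], and this combination only sees the positions in [w], not the
    letters. So the same linear form computes the logarithm of the group-like
    series e^(x_1) ... e^(x_n), where it can be read off because the multilinear
    coefficients of that series are those of the single word x_1 ... x_n.
    Comparing both gives log f = sum_u f(u) CBH_n(u) ([nclog_grouplike]).

    The coefficients (a formula of Le and Murakami). Let [f] be group-like and
    zero on the letters. Summing f(rev a) times the terms of [C_generating a]
    over all words [a] and all deleted sets [S], [T], the terms that leave a
    given word u and delete p letters A_1 and q letters A_0 add up, by the
    shuffle relations, to f(u) f(A_1^p) f(A_0^q), which is 0 unless p = q = 0.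
    What remains is f. On the other hand [C_generating a] is 0 when [a] is not
    admissible, as deleting and keeping an extreme letter cancel. Hence only the
    admissible words contribute ([admissible_expansion]).

    The analysis. The system satisfied by the coefficients of a solution is
    triangular: the derivative at a word only involves a shorter word. So a
    quantity that is built from solutions and vanishes on shorter words is
    constant, and the asymptotic condition tells which constant. This shows that
    [G0] and [G1] are real ([KZ_system_eq0]), group-like
    ([KZ_system_grouplike]), and known at the letters ([KZ_system_letter]). As
    the inverse of a group-like series is its antipode,
    Phi = antipode (G1 s) * G0 s for all s in ]0, 1[. If a_n = 0, then
    s |-> (-1)^n G1(s)(a) tends to 0 at 1 and satisfies the differential
    recursion of the iterated integral of the forms a_1, ..., a_n over
    s <= t_1 <= ... <= t_n <= 1, so it is that integral ([simplex_integralE]).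
    When s tends to 0, the other terms in the coefficient of Phi are products of
    a coefficient of [G1], which is o(1/s), and of a coefficient of [G0] at a
    word that ends with A_1, which is O(s); so the coefficient of [Phi] at the
    reversal of an admissible [a] is [omega a] ([omega_real_associator]). *)

Set Implicit Arguments.
Unset Strict Implicit.
Unset Printing Implicit Defensive.

Import Order.TTheory GRing.Theory Num.Theory.
Import numFieldNormedType.Exports.

Local Open Scope ring_scope.

(** * Shuffles and the coproduct *)

Section Shuffles.
Variable T : eqType.
Implicit Types (u v w : seq T) (x y : T).

Fixpoint shuffles u : seq T -> seq (seq T) :=
  if u is x :: u' then
    fix shuffles_u v := if v is y :: v' then
        map (cons x) (shuffles u' v) ++ map (cons y) (shuffles_u v')
      else [:: u]
  else fun v => [:: v].

Lemma shuffless0 u : shuffles u [::] = [:: u]. Proof. by case: u. Qed.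

Lemma shuffles_cons x u y v : shuffles (x :: u) (y :: v) =
  map (cons x) (shuffles u (y :: v)) ++ map (cons y) (shuffles (x :: u) v).
Proof. by []. Qed.

Lemma shuffles_perm u v w : w \in shuffles u v -> perm_eq w (u ++ v).
Proof.
elim: u v w => [|x u IHu] v w; first by rewrite inE => /eqP ->.
elim: v w => [|y v IHv] w.
  by rewrite inE cats0 => /eqP ->.
rewrite shuffles_cons mem_cat => /orP[] /mapP[w' + ->].
  by move/IHu; rewrite /= perm_cons.
move/IHv => w'P; rewrite -[y :: v]cat1s perm_sym perm_catCA perm_sym.
by rewrite perm_cons.
Qed.

End Shuffles.

Lemma shuffles_map (T U : eqType) (h : T -> U) (u v : seq T) :
  shuffles (map h u) (map h v) = map (map h) (shuffles u v).
Proof.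
elim: u v => [|x u IHu] v //; elim: v => [|y v IHv] //.
rewrite [map h (x :: u)]/= [map h (y :: v)]/= !shuffles_cons map_cat.
rewrite -!map_comp -[h y :: map h v]/(map h (y :: v)) IHu.
by rewrite -[h x :: map h u]/(map h (x :: u)) IHv -!map_comp.
Qed.

Section Coproduct.
Variables (T : eqType) (K : comNzRingType).
Implicit Types (f g : ncseries T K) (u v w : seq T) (x y : T).

Definition lder x f : ncseries T K := NCSeries (fun w => f (x :: w)).

Definition coprod f u v : K := \sum_(w <- shuffles u v) f w.

Lemma coprod0s f v : coprod f [::] v = f v.
Proof. by rewrite /coprod big_seq1. Qed.

Lemma coprods0 f u : coprod f u [::] = f u.
Proof. by rewrite /coprod shuffless0 big_seq1. Qed.

Lemma coprod_cons f x u y v : coprod f (x :: u) (y :: v) =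
  coprod (lder x f) u (y :: v) + coprod (lder y f) (x :: u) v.
Proof. by rewrite /coprod shuffles_cons big_cat !big_map. Qed.

Lemma coprodD f g u v : coprod (f + g) u v = coprod f u v + coprod g u v.
Proof. by rewrite /coprod -big_split. Qed.

Lemma coprodZ c f u v : coprod (c *: f) u v = c * coprod f u v.
Proof. by rewrite /coprod mulr_sumr. Qed.

Lemma lderM x f g : lder x (f * g) = f [::] *: lder x g + lder x f * g.
Proof.
apply: ncseriesP => w; rewrite nccoefD nccoefZ [LHS]nccoefM /=.
by rewrite big_ord_recl.
Qed.

Lemma nccoefM_nil f g : (f * g) [::] = f [::] * g [::].
Proof. by rewrite nccoefM big_ord1. Qed.

Lemma nccoefM_cons f g x w :
  (f * g) (x :: w) = f [::] * g (x :: w) + (lder x f * g) w.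
Proof. by rewrite nccoefM big_ord_recl. Qed.

(** The product of the completed tensor square of the series ring, for elements
    given by their coefficients at pairs of words. *)
Definition tensor_mul (F G : seq T -> seq T -> K) u v : K :=
  \sum_(i < (size u).+1) \sum_(j < (size v).+1)
    F (take i u) (take j v) * G (drop i u) (drop j v).

(** [coprod] is dual to the shuffle product, hence multiplicative: cutting a
    shuffle of [u] and [v] in two amounts to cutting [u] and [v] first and to
    shuffling the left parts and the right parts. *)
Lemma coprodM f g u v : coprod (f * g) u v = tensor_mul (coprod f) (coprod g) u v.
Proof.
elim: u v f => [|x u IHu] v f.
  rewrite coprod0s /tensor_mul big_ord1 nccoefM; apply: eq_bigr => j _.
  by rewrite /= !coprod0s.
elim: v f => [|y v IHv] f.
  rewrite coprods0 nccoefM; apply: eq_bigr => i _.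
  by rewrite big_ord1 !coprods0.
rewrite coprod_cons !lderM !coprodD !coprodZ IHu IHv.
rewrite [RHS]/tensor_mul big_ord_recl [X in _ = X + _]big_ord_recl /=.
rewrite coprod0s coprod_cons mulrDr -!addrA; congr (_ + _).
rewrite [LHS]addrCA; congr (_ + _).
rewrite addrC /tensor_mul big_ord_recl -addrA; congr (_ + _).
  by apply: eq_bigr => j _; rewrite /= !coprod0s.
rewrite -big_split /=; apply: eq_bigr => i _.
rewrite addrC big_ord_recl [RHS]big_ord_recl /= !coprods0 -addrA.
congr (_ + _).
rewrite -big_split /=; apply: eq_bigr => j _.
by rewrite coprod_cons mulrDl.
Qed.

End Coproduct.

Lemma size_shuffles (T : eqType) (u v : seq T) :
  size (shuffles u v) = 'C(size u + size v, size u).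
Proof.
elim: u v => [|x u IHu] v; first by rewrite bin0.
elim: v => [|y v IHv]; first by rewrite /= addn0 binn.
rewrite shuffles_cons size_cat !size_map IHu IHv /= !addnS !addSn binS addnC.
by [].
Qed.

(** * Group-like series *)

Section Grouplike.
Variables (T : eqType) (K : comNzRingType).
Implicit Types (e f g : ncseries T K) (u v w : seq T) (x y : T).

Definition grouplike f : Prop :=
  f [::] = 1 /\ forall u v, coprod f u v = f u * f v.

Lemma nccoefM_tensor_mul f g f' g' u v : (f * g) u * (f' * g') v =
  tensor_mul (fun u1 v1 => f u1 * f' v1) (fun u2 v2 => g u2 * g' v2) u v.
Proof.
rewrite !nccoefM mulr_suml; apply: eq_bigr => i _; rewrite mulr_sumr.
by apply: eq_bigr => j _; rewrite mulrACA.
Qed.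

Lemma eq_tensor_mul (F F' G G' : seq T -> seq T -> K) u v :
  (forall u1 v1, F u1 v1 = F' u1 v1) -> (forall u1 v1, G u1 v1 = G' u1 v1) ->
  tensor_mul F G u v = tensor_mul F' G' u v.
Proof.
by move=> eF eG; apply: eq_bigr => i _; apply: eq_bigr => j _; rewrite eF eG.
Qed.

Lemma grouplikeM f g : grouplike f -> grouplike g -> grouplike (f * g).
Proof.
move=> [f1 fP] [g1 gP]; split=> [|u v]; first by rewrite nccoefM_nil f1 g1 mulr1.
by rewrite coprodM nccoefM_tensor_mul; apply: eq_tensor_mul.
Qed.

(** When [F] and [F'] agree on smaller pairs, only the term in which [G] takes
    its value 1 at the pair of empty words sees their difference. This triangular
    argument is what allows inductions on the total length of [u] and [v]. *)
Lemma tensor_mul_defectl (F F' G : seq T -> seq T -> K) u v :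
  G [::] [::] = 1 ->
  (forall u1 v1, (size u1 + size v1 < size u + size v)%N -> F u1 v1 = F' u1 v1) ->
  tensor_mul F G u v - tensor_mul F' G u v = F u v - F' u v.
Proof.
move=> G1 FF'; rewrite /tensor_mul !pair_big /=.
rewrite (bigD1 (ord_max, ord_max)) //= [X in _ - X](bigD1 (ord_max, ord_max)) //=.
rewrite !take_size !drop_size G1 !mulr1.
rewrite opprD addrACA [X in _ + X](_ : _ = 0) ?addr0 //.
apply/eqP; rewrite subr_eq0; apply/eqP; apply: eq_bigr => -[i j] ne /=.
rewrite FF' // !size_take_min; have [lei lej] := (leq_ord i, leq_ord j).
rewrite (minn_idPl lei) (minn_idPl lej) ltnNge; apply: contraNN ne => le.
by rewrite -pair_eqE /= -!val_eqE /=; lia.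
Qed.

Lemma tensor_mul_defectr (F G G' : seq T -> seq T -> K) u v :
  F [::] [::] = 1 ->
  (forall u1 v1, (size u1 + size v1 < size u + size v)%N -> G u1 v1 = G' u1 v1) ->
  tensor_mul F G u v - tensor_mul F G' u v = G u v - G' u v.
Proof.
move=> F1 GG'; rewrite /tensor_mul !pair_big /=.
rewrite (bigD1 (ord0, ord0)) //= [X in _ - X](bigD1 (ord0, ord0)) //=.
rewrite !take0 !drop0 F1 !mul1r.
rewrite opprD addrACA [X in _ + X](_ : _ = 0) ?addr0 //.
apply/eqP; rewrite subr_eq0; apply/eqP; apply: eq_bigr => -[i j] ne /=.
rewrite GG' // !size_drop; have [lei lej] := (leq_ord i, leq_ord j).
rewrite ltnNge; apply: contraNN ne => le; rewrite -pair_eqE /= -!val_eqE /=; lia.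
Qed.

(** The failure of [f] to be group-like, in the least degree where it occurs, is
    not changed by a group-like factor; so it can be read on [f * e], whose
    limit is known when [f] is a solution. *)
Lemma grouplike_defect f e u v : grouplike e ->
  (forall u1 v1, (size u1 + size v1 < size u + size v)%N ->
     coprod f u1 v1 = f u1 * f v1) ->
  coprod (f * e) u v - (f * e) u * (f * e) v = coprod f u v - f u * f v.
Proof.
move=> [e1 eP] fP; rewrite coprodM nccoefM_tensor_mul.
rewrite (@eq_tensor_mul (coprod f) (coprod f) (coprod e) (fun u v => e u * e v)) //.
by apply: tensor_mul_defectl => //; rewrite e1 mulr1.
Qed.

Lemma grouplike_divl f g : grouplike f -> grouplike (f * g) -> grouplike g.
Proof.
move=> [f1 fP] [fg1 fgP]; split=> [|u v].
  by rewrite -fg1 nccoefM_nil f1 mul1r.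
have [n] := ubnP (size u + size v); elim: n u v => // n IHn u v lt_n.
have := fgP u v; rewrite coprodM nccoefM_tensor_mul.
rewrite (@eq_tensor_mul (coprod f) (fun u v => f u * f v) (coprod g) (coprod g)) //.
move/eqP; rewrite -subr_eq0 tensor_mul_defectr ?f1 ?mulr1 ?subr_eq0 => [/eqP //|//|].
by move=> u1 v1 lt1; apply: IHn; apply: leq_trans lt1 _; rewrite -ltnS.
Qed.

Definition antipode f : ncseries T K :=
  NCSeries (fun w => (-1) ^+ size w * f (rev w)).

(** By the shuffle relations, the terms of the coefficient at [w] are the values
    of the coproduct at the reversed prefix and the suffix of [w]. A shuffle of
    these begins with one of the two letters adjacent to the cut, so that each
    term splits in two halves, and the halves of consecutive terms cancel. *)
Lemma antipodeM f : grouplike f -> antipode f * f = 1.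
Proof.
move=> [f1 fP]; apply: ncseriesP => -[|x w].
  by rewrite nccoefM_nil /= f1 !mulr1.
rewrite nccoefM nccoef1 /=; set s := x :: w.
(* The half that belongs to the cuts on either side of the letter [k]. *)
pose t k := coprod (lder (nth x s k) f) (rev (take k s)) (drop k.+1 s).
have termE (k : nat) : (k <= size s)%N ->
    (-1) ^+ size (take k s) * f (rev (take k s)) * f (drop k s) =
    (-1) ^+ k * ((if k is k'.+1 then t k' else 0) +
                 (if (k < size s)%N then t k else 0)).
  move=> le_k; rewrite -mulrA -fP size_takel //; congr (_ * _).
  case: ltnP => lt_k; last first.
    have -> : k = (size w).+1 by apply/eqP; rewrite eqn_leq le_k.
    rewrite addr0 /t drop_oversize // !coprods0.
    by rewrite (take_nth x) // rev_rcons.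
  rewrite (drop_nth x lt_k); case: k le_k lt_k => [|k] le_k lt_k.
    by rewrite take0 coprod0s add0r /t take0 coprod0s.
  rewrite (take_nth x) ?(ltnW lt_k) // rev_rcons coprod_cons /t.
  by rewrite -(drop_nth x lt_k) -rev_rcons -take_nth // ltnW.
rewrite (eq_bigr (fun k : 'I_(size s).+1 => (-1) ^+ k *
   ((if val k is k'.+1 then t k' else 0) +
    (if (k < size s)%N then t k else 0)))); last first.
  by move=> k _; rewrite /= -termE // -ltnS.
under eq_bigr do rewrite mulrDr; rewrite big_split /=.
rewrite big_ord_recl mulr0 add0r [X in _ + X]big_ord_recr /= ltnn mulr0 addr0.
rewrite -big_split big1 //= => k _.
by rewrite ltn_ord /bump /= add1n exprS mulN1r mulNr addNr.
Qed.

End Grouplike.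

Section Unit.
Variables (T : eqType) (K : comNzRingType).
Implicit Types (f g : ncseries T K) (w : seq T).

Lemma nccoefX_small f k w : f [::] = 0 -> (size w < k)%N -> (f ^+ k) w = 0.
Proof.
move=> f0; elim: k w => // k IHk w lt_w; rewrite exprS nccoefM big1 // => i _.
case: (posnP i) => [->|i_gt0]; first by rewrite take0 f0 mul0r.
by rewrite IHk ?mulr0 // size_drop; have := leq_ord i; lia.
Qed.

(** The inverse is the geometric series in [1 - f]; only finitely many of its
    terms contribute to a given coefficient. *)
Lemma ncseries_unit f : f [::] = 1 -> f \is a GRing.unit.
Proof.
move=> f1; pose h := 1 - f.
have h0 : h [::] = 0 by rewrite nccoefB f1 nccoef1 subrr.
pose S N := \sum_(k < N) h ^+ k.
pose g : ncseries T K := NCSeries (fun w => S (size w).+1 w).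
have gE N w : (size w < N)%N -> g w = S N w.
  move=> lt_w; rewrite /g /= /S !nccoef_sum.
  rewrite (big_ord_widen _ (fun k => (h ^+ k) w) lt_w).
  rewrite big_mkcond; apply: eq_bigr => k _.
  by case: ltnP => // lt_k; rewrite nccoefX_small.
have fE : f = - (h - 1) by rewrite addrAC subrr add0r opprK.
have fS N : f * S N = 1 - h ^+ N by rewrite fE mulNr -subrX1 opprB.
have Sf N : S N * f = 1 - h ^+ N.
  rewrite -fS; apply/commr_sym/commr_sum => k _; apply: commrX.
  by rewrite fE opprB; apply/commr_sym/commrB; [exact: commr1|].
suff [gf fg] : g * f = 1 /\ f * g = 1 by apply/asboolP; exists g.
split; apply: ncseriesP => w.
  rewrite -[RHS]subr0 -(@nccoefX_small h (size w).+1 w) // -nccoefB -Sf !nccoefM.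
  by apply: eq_bigr => k _; rewrite (gE (size w).+1) // size_take_min; lia.
rewrite -[RHS]subr0 -(@nccoefX_small h (size w).+1 w) // -nccoefB -fS !nccoefM.
by apply: eq_bigr => k _; rewrite (gE (size w).+1) // size_drop; lia.
Qed.

End Unit.

Section Exponential.
Variables (T : eqType) (K : numFieldType).
Implicit Types (u v w : seq T) (x : T) (c : K).

Lemma ncvarX x k w : ((ncvar x : ncseries T K) ^+ k) w = (w == nseq k x)%:R.
Proof.
rewrite -(prod_ncvar K); congr (nccoef _ w).
by rewrite big_nseq; elim: k => // k IHk; rewrite exprS IHk.
Qed.

Lemma ncexp_var c x w : ncexp (c *: ncvar x : ncseries T K) w =
  if all (pred1 x) w then c ^+ size w / (size w)`!%:R else 0.
Proof.
rewrite /= nccoef_sum; under eq_bigr do rewrite nccoefZ exprZn nccoefZ ncvarX.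
case: all_pred1P => [wE|w_ne].
  rewrite big_nat_recr //= big_nat big1 ?add0r => [|k ltk].
    by rewrite -wE eqxx mulr1 mulrC.
  case: eqP => [|_]; rewrite ?mulr0 // => /(congr1 size).
  by rewrite size_nseq => sz; rewrite sz ltnn in ltk.
rewrite big1 // => k _; case: eqP => [wE|_]; rewrite ?mulr0 //.
by case: w_ne; rewrite {1}wE; congr nseq; rewrite wE size_nseq.
Qed.

(** All shuffles of powers of [x] are the same word, and there are as many of
    them as the binomial coefficient in the product of two exponentials. *)
Lemma grouplike_ncexp c x : grouplike (ncexp (c *: ncvar x : ncseries T K)).
Proof.
split=> [|u v]; first by rewrite ncexp_var /= mul1r invr1.
rewrite /coprod big_seq (eq_bigr (fun=> ncexp (c *: ncvar x) (u ++ v))).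
  rewrite -big_seq big_const_seq count_predT iter_addr_0 size_shuffles.
  rewrite !ncexp_var all_cat size_cat; case: (all _ u); last by rewrite mul0r mul0rn.
  case: (all _ v); rewrite /= ?mulr0 ?mul0rn //.
  rewrite -[LHS]mulr_natr exprD mulrACA -!mulrA; congr (_ * (_ * _)).
  have /(congr1 (fun n => n%:R : K)) := bin_fact (leq_addr (size v) (size u)).
  rewrite addKn !natrM => <-.
  rewrite invfM mulrAC mulVf ?mul1r ?invfM // pnatr_eq0 -lt0n bin_gt0.
  exact: leq_addr.
by move=> w /shuffles_perm pw; rewrite !ncexp_var (perm_all _ pw) (perm_size pw).
Qed.

End Exponential.

(** * The logarithm of a group-like series *)

Section ShufflePower.
Variable T : eqType.
Implicit Types (v w : seq T).

(** All shuffles of the [k] pieces of [w], over all ways to cut [w] in [k]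
    consecutive pieces: the coefficients of the linear form that computes the
    [k]-th power of a group-like series. *)
Fixpoint shuffle_power k w : seq (seq T) :=
  if k is k'.+1 then
    flatten [seq flatten [seq shuffles (take j w) v | v <- shuffle_power k' (drop j w)]
            | j <- index_iota 0 (size w).+1]
  else nseq (w == [::]) [::].

Lemma shuffle_powerS k w : shuffle_power k.+1 w =
  flatten [seq flatten [seq shuffles (take j w) v | v <- shuffle_power k (drop j w)]
          | j <- index_iota 0 (size w).+1].
Proof. by []. Qed.

Lemma shuffle_power_perm k v w : v \in shuffle_power k w -> perm_eq v w.
Proof.
elim: k v w => [|k IHk] v w.
  by rewrite /=; case: eqP => [->|//]; rewrite mem_seq1 => /eqP ->.
rewrite shuffle_powerS => /flatten_mapP[j _ /flatten_mapP[v' /IHk v'P /shuffles_perm vP]].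
by rewrite (perm_trans vP) // -{2}(cat_take_drop j w) perm_cat2l.
Qed.

End ShufflePower.

(** Shuffling moves positions and ignores letters. This allows to compare the
    linear form at [w] with the one at a word with distinct letters. *)
Lemma shuffle_power_map (T U : eqType) (h : T -> U) k (w : seq T) :
  shuffle_power k (map h w) = map (map h) (shuffle_power k w).
Proof.
elim: k w => [|k IHk] w; first by case: w.
rewrite !shuffle_powerS size_map map_flatten -map_comp; congr flatten; apply: eq_map => j /=.
rewrite -map_drop IHk map_flatten -!map_comp; congr flatten; apply: eq_map => v /=.
by rewrite -map_take shuffles_map.
Qed.

Section LogGrouplike.
Variables (T : eqType) (K : numFieldType).
Implicit Types (f : ncseries T K) (v w : seq T).

Lemma grouplikeX f k w : grouplike f ->
  (f ^+ k) w = \sum_(v <- shuffle_power k w) f v.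
Proof.
move=> [f1 fP]; elim: k w => [|k IHk] w.
  by rewrite nccoef1 /=; case: eqP => _; rewrite /= ?big_nil // big_seq1 f1.
rewrite exprS nccoefM shuffle_powerS big_flatten big_map big_mkord; apply: eq_bigr => j _.
by rewrite big_flatten big_map IHk mulr_sumr; apply: eq_bigr => v _; rewrite -fP.
Qed.

(** The logarithm, truncated in degree [n], in terms of the powers of the
    series instead of those of the series minus 1. *)
Definition log_of_powers n (P : nat -> K) : K :=
  \sum_(1 <= k < n.+1) (-1) ^+ k.+1 / k%:R *
    \sum_(i < k.+1) ((-1) ^+ i * P (k - i)%N) *+ 'C(k, i).

Lemma exprB1 f k : (f - 1) ^+ k =
  \sum_(i < k.+1) ((-1) ^+ i *: f ^+ (k - i)) *+ 'C(k, i).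
Proof.
rewrite exprBn_comm; last exact: commr1.
apply: eq_bigr => i _; congr (_ *+ _); rewrite expr1n mulr1.
by rewrite -signr_odd -[in RHS]signr_odd; case: odd; rewrite ?mul1r ?scale1r ?mulN1r ?scaleN1r.
Qed.

Lemma nclogE f w : nclog f w = log_of_powers (size w) (fun k => (f ^+ k) w).
Proof.
rewrite [LHS]nccoef_sum; apply: eq_bigr => k _; rewrite nccoefZ; congr (_ * _).
rewrite exprB1 nccoef_sum; apply: eq_bigr => i _.
by rewrite -scaler_nat nccoefZ nccoefZ mulr_natl.
Qed.

Lemma log_of_powers_sum n (I : Type) (r : seq I) (P : pred I) (a : I -> K)
    (Q : I -> nat -> K) :
  \sum_(i <- r | P i) a i * log_of_powers n (Q i) =
  log_of_powers n (fun k => \sum_(i <- r | P i) a i * Q i k).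
Proof.
under eq_bigr do rewrite mulr_sumr.
rewrite exchange_big /=; apply: eq_bigr => k _.
under eq_bigr do rewrite mulrCA mulr_sumr.
rewrite -mulr_sumr exchange_big /=; congr (_ * _); apply: eq_bigr => j _.
rewrite mulr_sumr -sumrMnl; apply: eq_bigr => i _.
by rewrite mulrnAr mulrCA.
Qed.

Lemma eq_log_of_powers n (P Q : nat -> K) : P =1 Q ->
  log_of_powers n P = log_of_powers n Q.
Proof. by move=> /funext ->. Qed.

Lemma grouplike1 : grouplike (1 : ncseries T K).
Proof.
split=> // u v; rewrite /coprod big_seq (eq_bigr (fun=> ((u ++ v) == [::])%:R)).
  rewrite -big_seq big_const_seq count_predT iter_addr_0 size_shuffles !nccoef1.
  by case: u v => [|x u] [|y v]; rewrite /= ?mul1r ?mul0r ?mul0rn // bin0.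
by move=> w /shuffles_perm/perm_size; rewrite nccoef1 -!size_eq0 => ->.
Qed.

Lemma grouplike_prod (I : Type) (r : seq I) (F : I -> ncseries T K) :
  (forall i, grouplike (F i)) -> grouplike (\prod_(i <- r) F i).
Proof.
move=> GF; elim/big_ind: _ => // [|f g]; [exact: grouplike1|exact: grouplikeM].
Qed.

(** A word without repetition takes at most one letter from each exponential, in
    the order of [s]. In particular the only permutation of [s] with a nonzero
    coefficient is [s]. *)
Lemma prod_ncexp_uniq (s w : seq T) : uniq s -> uniq w ->
  (\prod_(x <- s) ncexp (ncvar x : ncseries T K)) w = (subseq w s)%:R.
Proof.
elim: s w => [|x s IHs] w; first by rewrite big_nil subseq0.
rewrite big_cons => /andP[xs us].
have expE v : ncexp (ncvar x : ncseries T K) v =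
    if all (pred1 x) v then (size v)`!%:R^-1 else 0.
  by rewrite -[ncvar x]scale1r ncexp_var expr1n mul1r.
move: expE; set e := ncexp _ => expE; clearbody e.
case: w => [|y w] uw; first by rewrite nccoefM_nil IHs // expE invr1 mul1r !sub0seq.
rewrite nccoefM !big_ord_recl addrA [X in _ + X]big1 ?addr0 => [|j _]; last first.
  rewrite expE; case: w uw j => [_ []//|z w] /= uw j.
  case: ifP => [/and3P[/eqP yx /eqP zx _]|_]; rewrite ?mul0r //.
  by move: uw; rewrite yx zx mem_head.
rewrite !expE /= invr1 mul1r take0 drop0 andbT.
rewrite IHs //; have [yx|_] := eqVneq y x; last by rewrite mul0r addr0.
rewrite IHs ?invr1 ?mul1r; [|by []|by case/andP: uw].
case: (boolP (subseq (y :: w) s)) => [/mem_subseq/(_ y (mem_head _ _))|_].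
  by rewrite yx (negPf xs).
by rewrite add0r.
Qed.

End LogGrouplike.

Section CBHLog.
Variables (T : finType) (K : numFieldType).
Implicit Types (f : ncseries T K).

Lemma multilinearP n (p : n.-tuple 'I_n) :
  reflect (perm_eq p (enum 'I_n)) [forall j, count_mem j p == 1%N].
Proof.
have c1 (j : 'I_n) : count_mem j (enum 'I_n) = 1%N.
  by rewrite count_uniq_mem ?enum_uniq // mem_enum.
apply: (iffP forallP) => [pP|/permP pP j]; last by rewrite pP c1.
by apply/allP => j _ /=; rewrite c1.
Qed.

(** The only permutation [p] that can contribute is the inverse of [q], and then
    [u] must be [w] rearranged by [q]. *)
Lemma sum_perm_inverse n (u w : n.-tuple T) (q : seq 'I_n) :
  perm_eq q (enum 'I_n) ->
  \sum_(p : n.-tuple 'I_n | [forall j, count_mem j p == 1%N])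
     (w == map (tnth u) p :> seq T)%:R * (map (tnth p) q == enum 'I_n)%:R =
  (u == map (tnth w) q :> seq T)%:R :> K.
Proof.
move=> pq; have szq : size q == n by rewrite (perm_size pq) size_enum_ord.
pose qt := Tuple szq.
have inj_q : injective (tnth qt).
  by apply/tuple_uniqP; rewrite (perm_uniq pq) enum_uniq.
pose s := invF inj_q.
pose p0 : n.-tuple 'I_n := [tuple s j | j < n].
have p0P : [forall j, count_mem j p0 == 1%N].
  apply/multilinearP; apply: uniq_perm; rewrite ?enum_uniq //.
    by apply/tuple_uniqP => i j; rewrite !tnth_mktuple => /(can_inj (f_invF inj_q)).
  move=> j; rewrite mem_enum; apply/tnthP; exists (tnth qt j).
  by rewrite tnth_mktuple /s invF_f.
have qE : q = [seq tnth qt j | j <- enum 'I_n] by rewrite map_tnth_enum.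
have p0q p : (map (tnth p) q == enum 'I_n) = (p == p0).
  apply/eqP/eqP => [pqE|->].
    apply: eq_from_tnth => j; rewrite tnth_mktuple -[j in LHS](f_invF inj_q).
    move: pqE; rewrite qE -map_comp -[RHS]map_id => /eq_in_map/(_ (s j)).
    by rewrite mem_enum /= => ->.
  rewrite qE -map_comp -[RHS]map_id; apply: eq_map => j /=.
  by rewrite tnth_mktuple /s invF_f.
rewrite (bigD1 p0) //= big1 => [|p /andP[_ /negPf ne]]; last first.
  by rewrite p0q ne mulr0.
rewrite p0q eqxx mulr1 addr0; congr (_%:R); congr (nat_of_bool _).
apply/eqP/eqP => wE.
  rewrite -[LHS]map_tnth_enum -(eqP (_ : map (tnth p0) q == enum 'I_n)) ?p0q //.
  have -> : w = map_tuple (tnth u) p0 by apply: val_inj.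
  by rewrite -map_comp; apply: eq_map => j; rewrite [RHS]tnth_map.
have -> : u = map_tuple (tnth w) qt by apply: val_inj.
rewrite -[LHS]map_tnth_enum -map_comp; apply: eq_map => j /=.
by rewrite [RHS]tnth_map /s f_invF.
Qed.

(** Both sides are evaluated with [shuffle_power] of the word of all positions:
    on the left, its elements [q] rearrange [w]; on the right, the coefficient
    of the power at [p] counts the [q] that are inverse to [p]. *)
Lemma grouplikeX_perm f n (w : n.-tuple T) k : grouplike f ->
  (f ^+ k) w = \sum_(u : n.-tuple T) f u *
    \sum_(p : n.-tuple 'I_n | [forall j, count_mem j p == 1%N])
      (w == map (tnth u) p :> seq T)%:R *
      ((\prod_(j < n) ncexp (ncvar j : ncseries 'I_n K)) ^+ k) p.
Proof.
move=> Gf; rewrite grouplikeX // -{1}[val w]map_tnth_enum shuffle_power_map.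
set X := \prod_(j < n) _.
have GX : grouplike X.
  by apply: grouplike_prod => j; rewrite -[ncvar j]scale1r; apply: grouplike_ncexp.
pose S := shuffle_power k (enum 'I_n).
have pS q : q \in S -> perm_eq q (enum 'I_n) by apply: shuffle_power_perm.
have XE (p : n.-tuple 'I_n) : [forall j, count_mem j p == 1%N] ->
    (X ^+ k) p = \sum_(q <- S) (map (tnth p) q == enum 'I_n)%:R.
  move=> pP; rewrite grouplikeX // -{1}[val p]map_tnth_enum shuffle_power_map.
  rewrite big_map big_seq [RHS]big_seq; apply: eq_bigr => q qS.
  have up : uniq p by rewrite (perm_uniq (multilinearP _ pP)) enum_uniq.
  have uq : uniq (map (tnth p) q).
    rewrite map_inj_uniq ?(perm_uniq (pS q qS)) ?enum_uniq //.
    exact/tuple_uniqP.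
  have -> : X = \prod_(j <- enum 'I_n) ncexp (ncvar j).
    by rewrite /X enumT [index_enum _]unlock.
  rewrite prod_ncexp_uniq ?enum_uniq //=; congr (_%:R).
  have szq : size (map (tnth p) q) = size (enum 'I_n).
    by rewrite size_map; apply: perm_size; apply: pS.
  congr nat_of_bool; apply/idP/eqP => [sub|->//].
  by apply/eqP; rewrite -(size_subseq_leqif sub) szq.
rewrite big_map big_seq; under eq_bigr => q qS.
  have -> : f (map (tnth w) q) = \sum_(u : n.-tuple T) f u *
      (u == map (tnth w) q :> seq T)%:R.
    have szq : size (map (tnth w) q) == n.
      by rewrite size_map (perm_size (pS q qS)) size_enum_ord.
    rewrite (bigD1 (Tuple szq)) //= eqxx mulr1 big1 ?addr0 // => u.
    by rewrite -val_eqE /= => /negPf ->; rewrite mulr0.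
  under eq_bigr do rewrite -(sum_perm_inverse _ _ (pS q qS)).
over.
rewrite -big_seq exchange_big; apply: eq_bigr => u _ /=.
rewrite -mulr_sumr exchange_big /=; congr (_ * _); apply: eq_bigr => p pP.
by rewrite XE // mulr_sumr.
Qed.

Lemma CBH_eval_coef n (u : n.-tuple T) (w : seq T) :
  CBH_eval (fun j : 'I_n => ncvar (tnth u j) : ncseries T K) w =
  \sum_(p : n.-tuple 'I_n) CBH K n p * (w == map (tnth u) p)%:R.
Proof.
rewrite /CBH_eval /nceval nccoef_sum big_ord_recr /= big1 ?add0r => [|k _].
  rewrite nccoef_sum; apply: eq_bigr => p _; rewrite nccoefZ; congr (_ * _).
  by rewrite -prod_ncvar big_map.
rewrite nccoef_sum big1 // => p _; rewrite nccoefZ /CBH /multilinear_part /=.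
case: ifP => [/forallP pP|_]; last by rewrite mul0r.
have /perm_size : perm_eq p (enum 'I_n).
  by apply/allP => j _ /=; rewrite (eqP (pP j)) count_uniq_mem ?enum_uniq ?mem_enum.
by rewrite size_tuple size_enum_ord => kn; have := ltnn n; rewrite -{1}kn ltn_ord.
Qed.

Lemma CBH_eval_homog n (u : n.-tuple T) (w : seq T) : size w != n ->
  CBH_eval (fun j : 'I_n => ncvar (tnth u j) : ncseries T K) w = 0.
Proof.
move=> wn; rewrite CBH_eval_coef big1 // => p _; case: eqP => [wE|_].
  by rewrite wE size_map size_tuple eqxx in wn.
by rewrite mulr0.
Qed.

(** The identity between powers given by [grouplikeX_perm] passes to the
    logarithm by linearity. *)
Lemma nclog_grouplike f n (w : n.-tuple T) : grouplike f ->
  nclog f w = \sum_(u : n.-tuple T)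
    f u * CBH_eval (fun j : 'I_n => ncvar (tnth u j) : ncseries T K) w.
Proof.
move=> Gf; rewrite nclogE size_tuple.
rewrite (eq_log_of_powers _ (fun k => grouplikeX_perm w k Gf)).
rewrite -log_of_powers_sum; apply: eq_bigr => u _; congr (_ * _).
rewrite -log_of_powers_sum CBH_eval_coef big_mkcond; apply: eq_bigr => p _.
have -> : CBH K n p = if [forall j, count_mem j p == 1%N]
    then nclog (\prod_(j < n) ncexp (ncvar j : ncseries 'I_n K)) p else 0 by [].
by case: ifP => _; rewrite ?mul0r // nclogE size_tuple mulrC.
Qed.

End CBHLog.

(** * The expansion over admissible words *)

Section TupleSums.
Variable V : zmodType.
Implicit Types F : seq bool -> V.

Lemma sum_tuple0 F : \sum_(t : 0.-tuple bool) F t = F [::].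
Proof. rewrite (big_pred1 [tuple]) // => t.
by apply/esym/eqP/val_inj; rewrite /= (size0nil (size_tuple t)). Qed.

Lemma sum_tupleS {n} F : \sum_(t : n.+1.-tuple bool) F t =
  \sum_(t : n.-tuple bool) (F (true :: t) + F (false :: t)).
Proof.
rewrite big_split /= (reindex (fun p : bool * n.-tuple bool => cons_tuple p.1 p.2)).
  by rewrite -(pair_big predT predT (fun b t => F (b :: tval t))) /= big_bool.
exists (fun t => (thead t, behead_tuple t)) => [[b t] _|t _].
  by congr pair; apply: val_inj.
by rewrite [RHS](tuple_eta t).
Qed.

Lemma sum_tuple_rev {n} F :
  \sum_(t : n.-tuple bool) F t = \sum_(t : n.-tuple bool) F (rev t).
Proof.
rewrite (reindex_inj (_ : injective (fun t : n.-tuple bool => rev_tuple t))) //=.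
by move=> s t /(congr1 val) /= /(can_inj revK) ?; apply: val_inj.
Qed.

Lemma sum_tuple_rcons {n} F : \sum_(t : n.+1.-tuple bool) F t =
  \sum_(t : n.-tuple bool) (F (rcons t true) + F (rcons t false)).
Proof.
rewrite sum_tuple_rev (sum_tupleS (fun t => F (rev t))).
rewrite [RHS](sum_tuple_rev (fun t => F (rcons t true) + F (rcons t false))).
by apply: eq_bigr => t _; rewrite !rev_cons.
Qed.

End TupleSums.

(** A pair of sets [S], [T] of deleted letters is encoded by one mask, since the
    deleted positions determine [S] and [T] by the letters that they carry. *)
Definition unmask (T : Type) (m : bitseq) (s : seq T) := mask (map negb m) s.

Definition regularized (b m : bitseq) : seq bool :=
  nseq (count id (unmask m b)) true ++ mask m b ++
  nseq (count negb (unmask m b)) false.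

Definition regular_coef (b m w : seq bool) : int :=
  (-1) ^+ size (unmask m b) * (w == regularized b m)%:R.

Section CGenerating.
Variable n : nat.
Implicit Types (a m : n.-tuple bool).

Lemma mask_tupleE a m :
  mask m a = map (tnth a) [seq i <- enum 'I_n | tnth m i].
Proof. by rewrite filter_mask map_mask !map_tnth_enum. Qed.

Lemma unmask_tupleE a m :
  unmask m a = map (tnth a) [seq i <- enum 'I_n | ~~ tnth m i].
Proof.
rewrite /unmask filter_mask map_mask map_tnth_enum; congr mask.
by rewrite -[in LHS](map_tnth_enum m) -map_comp.
Qed.

(** The word is reversed because the products in [C_generating a] list the
    letters of [a] from the last one to the first one. *)
Lemma C_generating_masks a w :
  C_generating a w = \sum_(m : n.-tuple bool) regular_coef (rev a) m w.
Proof.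
pose h m : {set 'I_n} * {set 'I_n} :=
  ([set i | ~~ tnth m i & ~~ tnth a i], [set i | ~~ tnth m i & tnth a i]).
pose h' (ST : {set 'I_n} * {set 'I_n}) : n.-tuple bool :=
  [tuple i \notin ST.1 :|: ST.2 | i < n].
rewrite /C_generating pair_big_dep /= (reindex_onto h h') /=; last first.
  move=> [S T] /= /andP[/fintype.subsetP S0 /fintype.subsetP T1].
  congr pair; apply/setP => i; rewrite !inE tnth_mktuple !inE negbK.
    move/implyP: (S0 i); move/implyP: (T1 i); rewrite !inE /=.
    by case: (i \in S); case: (i \in T); case: (tnth a i).
  move/implyP: (S0 i); move/implyP: (T1 i); rewrite !inE /=.
  by case: (i \in S); case: (i \in T); case: (tnth a i).
rewrite (eq_bigl xpredT) => [|m]; last first.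
  apply/andP; split; first apply/andP; first split.
  - by apply/fintype.subsetP => i; rewrite !inE => /andP[].
  - by apply/fintype.subsetP => i; rewrite !inE => /andP[].
  apply/eqP/eq_from_tnth => i; rewrite tnth_mktuple !inE.
  by case: (tnth m i); case: (tnth a i).
rewrite [RHS](sum_tuple_rev (fun m : seq bool => regular_coef (rev a) m w)).
rewrite nccoef_sum; apply: eq_bigr => m _.
have cT : #|[set i | ~~ tnth m i & tnth a i]| = count id (unmask m a).
  rewrite unmask_tupleE count_map count_filter cardE size_filter enumT.
  by apply: eq_count => i; rewrite !inE andbC.
have cS : #|[set i | ~~ tnth m i & ~~ tnth a i]| = count negb (unmask m a).
  rewrite unmask_tupleE count_map count_filter cardE size_filter enumT.
  by apply: eq_count => i; rewrite !inE andbC.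
have unmask_rev : unmask (rev m) (rev a) = rev (unmask m a).
  by rewrite /unmask map_rev -rev_mask // size_map !size_tuple.
rewrite cT cS /regular_coef /regularized unmask_rev !count_rev size_rev.
rewrite -rev_mask ?size_tuple // addnC -(count_predC id (unmask m a)).
rewrite -signr_odd -[in RHS]signr_odd; set e := odd _.
have AX b k : (ncvar b : ncseries bool int) ^+ k = \prod_(c <- nseq k b) ncvar c.
  by rewrite big_nseq; elim: k => // k IHk; rewrite exprS IHk.
have -> : C_word a [set i | ~~ tnth m i & ~~ tnth a i]
             [set i | ~~ tnth m i & tnth a i] =
          \prod_(c <- rev (mask m a)) ncvar c.
  rewrite mask_tupleE -map_rev big_map; congr (\prod_(c <- rev _) _).
  rewrite {1}/enum_mem -enumT; apply: eq_filter => i; rewrite !inE.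
  by case: (tnth m i); case: (tnth a i).
rewrite 2!AX -!big_cat -catA.
by case: e; rewrite ?mulN1r ?mul1r ?nccoefN prod_ncvar.
Qed.

End CGenerating.

Lemma nseq_shift (T : Type) p (x : T) s : nseq p x ++ x :: s = x :: nseq p x ++ s.
Proof. by elim: p => //= p ->. Qed.

(** Keeping the first letter A_1 or moving it to the front with the deleted ones
    gives the same word, with opposite signs. *)
Lemma regular_coef_head n (b w : seq bool) :
  \sum_(m : n.+1.-tuple bool) regular_coef (true :: b) m w = 0.
Proof.
rewrite (sum_tupleS (fun m => regular_coef (true :: b) m w)) big1 // => m _.
rewrite /regular_coef /regularized /unmask /= !add0n nseq_shift.
by rewrite exprS mulN1r mulNr addrN.
Qed.

(** As for [regular_coef_head], with the last letter A_0 and the back. *)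
Lemma regular_coef_last n (b : n.-tuple bool) w :
  \sum_(m : n.+1.-tuple bool) regular_coef (rcons b false) m w = 0.
Proof.
rewrite (sum_tuple_rcons (fun m => regular_coef (rcons b false) m w)) big1 // => m _.
rewrite /regular_coef /regularized /unmask !map_rcons.
rewrite !mask_rcons ?size_map ?size_tuple //= !cats0 !count_cat !size_cat /=.
by rewrite !addn0 !addn1 exprS mulN1r mulNr -catA /= addrN.
Qed.

Section Regularization.
Variable K : numFieldType.
Implicit Types (f : ncseries bool K) (u d w : seq bool).

(** The pairs of a word [b] and of a mask that splits [b] into [u] and [d] are
    the shuffles of [u] and [d]. *)
Lemma sum_mask_coprod n f u d :
  \sum_(b : n.-tuple bool) \sum_(m : n.-tuple bool)
    ((mask m b == u) && (unmask m b == d))%:R * f b =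
  if size u + size d == n then coprod f u d else 0.
Proof.
elim: n f u d => [|n IHn] f u d.
  rewrite (sum_tuple0 (fun b => \sum_(m : 0.-tuple bool)
     ((mask m b == u) && (unmask m b == d))%:R * f b)).
  rewrite (sum_tuple0 (fun m =>
     ((mask m [::] == u) && (unmask m [::] == d))%:R * f [::])).
  rewrite addn_eq0 !size_eq0 /= [in LHS]eq_sym [X in (_ && X)%:R]eq_sym.
  by case: eqP => [->|_]; case: eqP => [->|_]; rewrite /= ?mul0r ?mul1r ?coprod0s.
pose L f u d := \sum_(b : n.-tuple bool) \sum_(m : n.-tuple bool)
    ((mask m b == u) && (unmask m b == d))%:R * f b.
have -> : \sum_(b : n.+1.-tuple bool) \sum_(m : n.+1.-tuple bool)
    ((mask m b == u) && (unmask m b == d))%:R * f b =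
    (if u is z :: u0 then L (lder z f) u0 d else 0) +
    (if d is z :: d0 then L (lder z f) u d0 else 0).
  rewrite (sum_tupleS (fun b => \sum_(m : n.+1.-tuple bool)
     ((mask m b == u) && (unmask m b == d))%:R * f b)).
  transitivity (\sum_(b : n.-tuple bool) \sum_(m : n.-tuple bool)
    ((if u is z :: u0 then
      ((mask m b == u0) && (unmask m b == d))%:R * lder z f b else 0) +
     (if d is z :: d0 then
      ((mask m b == u) && (unmask m b == d0))%:R * lder z f b else 0))).
    apply: eq_bigr => b _.
    rewrite (sum_tupleS (fun m =>
      ((mask m (true :: b) == u) && (unmask m (true :: b) == d))%:R * f (true :: b))).
    rewrite (sum_tupleS (fun m =>
      ((mask m (false :: b) == u) && (unmask m (false :: b) == d))%:R * f (false :: b))).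
    rewrite -big_split /=; apply: eq_bigr => m _; rewrite /unmask /=.
    case: u d => [|[] u] [|[] d]; rewrite /= ?eqseq_cons ?andbF /=;
      rewrite ?mul0r ?addr0 ?add0r // addrC //.
  rewrite /L; case: u d => [|z u] [|y d]; rewrite ?addr0 ?add0r.
  - by rewrite big1 // => b _; rewrite big1 // => m _; rewrite addr0.
  - by apply: eq_bigr => b _; apply: eq_bigr => m _; rewrite add0r.
  - by apply: eq_bigr => b _; apply: eq_bigr => m _; rewrite addr0.
  by rewrite -big_split; apply: eq_bigr => b _; rewrite -big_split.
rewrite /L; case: u d => [|z u] [|y d]; rewrite ?IHn ?addr0 ?add0r //.
- by rewrite /= eqSS; case: eqP => // _; rewrite !coprod0s.
- by rewrite /= eqSS; case: eqP => // _; rewrite !coprods0.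
have -> : (size u + size (y :: d) == n) = (size (z :: u) + size (y :: d) == n.+1).
  by [].
have -> : (size (z :: u) + size d == n) = (size (z :: u) + size (y :: d) == n.+1).
  by rewrite -eqSS -addnS.
by case: eqP => _; rewrite ?addr0 // coprod_cons.
Qed.

(** The words with [p] letters [true] and [k - p] letters [false] are the shuffles
    of a power of [true] and of a power of [false]. *)
Lemma sum_count_coprod k p f :
  \sum_(d : k.-tuple bool) (count id d == p)%:R * f d =
  if (p <= k)%N then coprod f (nseq p true) (nseq (k - p) false) else 0.
Proof.
elim: k p f => [|k IHk] p f.
  rewrite (sum_tuple0 (fun d => (count id d == p)%:R * f d)) /= leqn0 eq_sym.
  by case: eqP => [->|_]; rewrite ?mul0r // mul1r coprod0s.
rewrite (sum_tupleS (fun d => (count id d == p)%:R * f d)) big_split /=.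
have := IHk p (lder false f) => /= ->.
case: p => [|p].
  rewrite big1 ?add0r => [|d _]; last by rewrite mul0r.
  by rewrite !subn0 !coprod0s.
have -> : \sum_(d : k.-tuple bool) ((1 + count id d)%N == p.+1)%:R * f (true :: d) =
    \sum_(d : k.-tuple bool) (count id d == p)%:R * lder true f d by [].
rewrite IHk ltnS; have [le_pk|lt_kp] := leqP p k; last first.
  by rewrite ltnNge (ltnW lt_kp) addr0.
rewrite subSS; case: ltnP => [lt_pk|ge_pk].
  by rewrite -(subnSK lt_pk) coprod_cons.
have -> : p = k by apply/eqP; rewrite eqn_leq le_pk.
by rewrite subnn -[nseq 0 false]/[::] !coprods0 addr0.
Qed.

(** By the shuffle relations the value at a power of [x] is, up to a nonzero
    integer, a power of the value at [x]. *)
Lemma grouplike_nseq f x p : grouplike f -> f [:: x] = 0 -> (0 < p)%N ->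
  f (nseq p x) = 0.
Proof.
move=> [f1 fP] fx; case: p => // p _; have := fP [:: x] (nseq p x).
rewrite fx mul0r /coprod big_seq (eq_bigr (fun=> f (nseq p.+1 x))).
  rewrite -big_seq big_const_seq count_predT iter_addr_0 size_shuffles.
  by move/eqP; rewrite mulrn_eq0 size_nseq bin1 /= => /eqP.
move=> v /shuffles_perm pv; have := all_pred1_nseq x p.+1.
rewrite -(perm_all _ pv) => /all_pred1P ->.
by rewrite (perm_size pv) /= size_nseq.
Qed.

Lemma size_unmask (m b : seq bool) : size m = size b ->
  (size (mask m b) + size (unmask m b))%N = size b.
Proof.
move=> mb; rewrite /unmask !size_mask ?size_map // count_map -mb.
exact: count_predC.
Qed.

(** The sum is split according to the numbers [p] and [q] of deleted letters A_1
    and A_0. For each pair it contains the factor f(A_1^p) f(A_0^q). *)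
Lemma grouplike_regularized n f w : grouplike f ->
  f [:: true] = 0 -> f [:: false] = 0 -> size w = n ->
  \sum_(b : n.-tuple bool) \sum_(m : n.-tuple bool)
    f b * (regular_coef b m w)%:~R = f w.
Proof.
move=> Gf f1 f0 wn.
(* If [p] and [q] letters are deleted, then this is the only word of kept letters
   that can give [w]. *)
pose part p q := take (n - (p + q)) (drop p w).
pose good p q := w == nseq p true ++ part p q ++ nseq q false.
pose sel p q (b m : seq bool) := [&& mask m b == part p q,
  count id (unmask m b) == p & count negb (unmask m b) == q].
have expand (b m : n.-tuple bool) : f b * (regular_coef b m w)%:~R =
  \sum_(p < n.+1) \sum_(q < n.+1) (-1) ^+ (p + q) * (good p q)%:R *
    ((sel p q b m)%:R * f b).
  have := @size_unmask m b; rewrite !size_tuple => /(_ erefl) szE.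
  have := count_predC id (unmask m b); set c1 := count id _.
  have -> : count (predC id) (unmask m b) = count negb (unmask m b) by [].
  set c0 := count negb _ => cE.
  have lt1 : (c1 < n.+1)%N by rewrite ltnS -szE -cE; lia.
  have lt0 : (c0 < n.+1)%N by rewrite ltnS -szE -cE; lia.
  rewrite (bigD1 (Ordinal lt1)) //= [X in _ + X]big1 ?addr0 => [|p]; last first.
    rewrite -val_eqE /= => ne; rewrite big1 // => q _.
    by rewrite /sel -/c1 [c1 == _]eq_sym (negPf ne) andbF mul0r mulr0.
  rewrite (bigD1 (Ordinal lt0)) //= [X in _ + X]big1 ?addr0 => [|q]; last first.
    rewrite -val_eqE /= => ne.
    by rewrite /sel -/c0 [c0 == _]eq_sym (negPf ne) !andbF mul0r mulr0.
  rewrite /sel -/c1 -/c0 !eqxx !andbT /regular_coef /regularized -/c1 -/c0 cE.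
  rewrite rmorphM /= rmorphXn /= rmorphN1 [LHS]mulrC -!mulrA; congr (_ * _).
  rewrite mulrA; congr (_ * _); rewrite -natrM mulnb /good.
  rewrite rmorph_nat; case: (eqVneq (mask m b) (part c1 c0)) => [->|ne].
    by rewrite andbT.
  rewrite andbF; case: eqP => // wE; case/eqP: ne.
  rewrite /part wE drop_size_cat ?size_nseq // take_size_cat // cE.
  by rewrite -[X in (X - _)%N]szE addnK.
transitivity (\sum_(p < n.+1) \sum_(q < n.+1) (-1) ^+ (p + q) * (good p q)%:R *
    \sum_(b : n.-tuple bool) \sum_(m : n.-tuple bool) (sel p q b m)%:R * f b).
  under eq_bigr do under eq_bigr do rewrite expand.
  under eq_bigr do rewrite exchange_big /=.
  rewrite exchange_big /=; apply: eq_bigr => p _.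
  under eq_bigr do rewrite exchange_big /=.
  rewrite exchange_big /=; apply: eq_bigr => q _.
  by rewrite mulr_sumr; apply: eq_bigr => b _; rewrite mulr_sumr.
have selE p q : \sum_(b : n.-tuple bool) \sum_(m : n.-tuple bool)
      (sel p q b m)%:R * f b =
    if size (part p q) + (p + q) == n
    then f (part p q) * (f (nseq p true) * f (nseq q false)) else 0.
  transitivity (\sum_(d : (p + q).-tuple bool) (count id d == p)%:R *
    \sum_(b : n.-tuple bool) \sum_(m : n.-tuple bool)
      ((mask m b == part p q) && (unmask m b == d))%:R * f b).
    under [RHS]eq_bigr do rewrite mulr_sumr.
    rewrite [RHS]exchange_big; apply: eq_bigr => b _ /=.
    under [RHS]eq_bigr do rewrite mulr_sumr.
    rewrite [RHS]exchange_big; apply: eq_bigr => m _ /=.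
    under [RHS]eq_bigr do rewrite mulrA.
    rewrite -mulr_suml; congr (_ * _); rewrite /sel.
    case: (mask m b == part p q) => /=; last by rewrite big1 // => d _; rewrite mulr0.
    have cE := count_predC id (unmask m b).
    case: (boolP (_ && _)) => [/andP[/eqP c1 /eqP c0]|ne].
      have sz : size (unmask m b) == (p + q)%N by rewrite -cE c1 -c0.
      rewrite (bigD1 (Tuple sz)) //= c1 !eqxx mulr1 big1 ?addr0 // => d.
      by rewrite -val_eqE /= eq_sym => /negPf ->; rewrite mulr0.
    rewrite big1 // => d _; case: eqP => [d1|_]; last by rewrite mul0r.
    case: eqP => [dE|_]; last by rewrite mulr0.
    case/negP: ne; rewrite dE d1 eqxx /=; apply/eqP.
    by have := count_predC id d; rewrite size_tuple d1 => /addnI.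
  under eq_bigr do rewrite sum_mask_coprod size_tuple.
  case: eqP => _; last by rewrite big1 // => d _; rewrite mulr0.
  under eq_bigr do rewrite (Gf.2) mulrCA.
  rewrite -mulr_sumr sum_count_coprod leq_addr addKn.
  by rewrite Gf.2.
under eq_bigr do under eq_bigr do rewrite selE.
rewrite (bigD1 ord0) //= (bigD1 ord0) //= !big1 ?addr0 => [|p|q].
- rewrite /good /part subn0 drop0 -wn take_size /= cats0 eqxx addn0 eqxx.
  by rewrite Gf.1 !mulr1 mul1r.
- rewrite -val_eqE /= -lt0n => p_gt0; rewrite big1 // => q _.
  by rewrite (grouplike_nseq Gf f1 p_gt0) mul0r !mulr0 if_same mulr0.
rewrite -val_eqE /= -lt0n => q_gt0.
by rewrite (grouplike_nseq Gf f0 q_gt0) !mulr0 if_same mulr0.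
Qed.

Lemma admissible_expansion n f w : grouplike f ->
  f [:: true] = 0 -> f [:: false] = 0 -> size w = n -> (0 < n)%N ->
  \sum_(a : n.-tuple bool | admissible a)
    f (rev a) * (C_generating a w)%:~R = f w.
Proof.
move=> Gf f1 f0 wn n_gt0; rewrite -[RHS](grouplike_regularized Gf f1 f0 wn).
rewrite [RHS](sum_tuple_rev (fun b : seq bool => \sum_(m : n.-tuple bool)
   f b * (regular_coef b m w)%:~R)) big_mkcond; apply: eq_bigr => a _ /=.
rewrite -mulr_sumr -rmorph_sum -C_generating_masks /=; case: ifPn => // nadm.
suff -> : C_generating a w = 0 by rewrite mulr0.
rewrite C_generating_masks; case: n n_gt0 a nadm {wn} => // n _ a.
rewrite /admissible negb_and => /orP[].
  case/tupleP: a => x a /=; case: x => // _; rewrite rev_cons.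
  exact: (regular_coef_last (rev_tuple a)).
case: (lastP a) (size_tuple a) => // s x; rewrite last_rcons size_rcons => -[szs].
by case: x => // _; rewrite rev_rcons; apply: regular_coef_head.
Qed.

End Regularization.

(** * Real analysis *)

Local Open Scope classical_set_scope.

Section RealAnalysis.
Variable R : realType.
Implicit Types (f g df dg : R -> R) (a b c C s t x y : R).

Lemma is_derive_continuous f x (l : R) : is_derive x (1 : R) f l -> {for x, continuous f}.
Proof. by move=> [d _]; apply/differentiable_continuous/derivable1_diffP. Qed.

Lemma is_derive_ndecr f df a b :
  (forall t, a < t < b -> is_derive t (1 : R) f (df t)) ->
  (forall t, a < t < b -> 0 <= df t) ->
  forall x y, a < x -> x <= y -> y < b -> f x <= f y.
Proof.
move=> fP df0 x y ax xy yb.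
apply: (@ger0_derive1_le_oo R f a b) => //.
- by move=> t; rewrite in_itv /= => /fP[].
- move=> t; rewrite in_itv /= => tab; have := fP t tab => -[_ ft].
  by rewrite derive1E ft df0.
- by move=> t; rewrite inE /= in_itv /= => /fP/is_derive_continuous.
- by rewrite in_itv /= ax (le_lt_trans xy).
- by rewrite in_itv /= yb (lt_le_trans ax).
Qed.

Lemma is_derive_bound f df g dg a b :
  (forall t, a < t < b -> is_derive t (1 : R) f (df t)) ->
  (forall t, a < t < b -> is_derive t (1 : R) g (dg t)) ->
  (forall t, a < t < b -> `|df t| <= dg t) ->
  forall x y, a < x -> x <= y -> y < b -> `|f y - f x| <= g y - g x.
Proof.
move=> fP gP le_fg x y ax xy yb.
have bounds t : a < t < b -> - dg t <= df t /\ df t <= dg t.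
  by move=> /le_fg; rewrite ler_norml => /andP.
have addle : g x + f x <= g y + f y.
  apply: (@is_derive_ndecr (fun t => g t + f t) (fun t => dg t + df t) a b) => // t tab.
    by apply: is_deriveD; [exact: gP|exact: fP].
  by have [+ _] := bounds t tab; rewrite -lerBlDl sub0r.
have suble : g x - f x <= g y - f y.
  apply: (@is_derive_ndecr (fun t => g t - f t) (fun t => dg t - df t) a b) => // t tab.
    by apply: is_deriveB; [exact: gP|exact: fP].
  by have [_] := bounds t tab; rewrite subr_ge0.
by rewrite ler_norml; apply/andP; split; lra.
Qed.

Lemma is_derive0_cst f a b : 
  (forall t, a < t < b -> is_derive t (1 : R) f 0) ->
  forall x y, a < x < b -> a < y < b -> f x = f y.
Proof.
move=> fP; suff le x y : a < x -> x <= y -> y < b -> f x = f y.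
  move=> x y /andP[ax xb] /andP[ay yb].
  by have [xy|/ltW yx] := leP x y; [exact: le|apply/esym/le].
move=> ax xy yb; apply/eqP; rewrite eq_sym -subr_eq0 -normr_le0.
rewrite -[X in _ <= X](subrr 0).
apply: (@is_derive_bound f (fun=> 0) (fun=> 0) (fun=> 0) a b) => // t _.
by rewrite normr0.
Qed.

Lemma is_deriveMl C f (l t : R) : is_derive t (1 : R) f l ->
  is_derive t (1 : R) (fun x => C * f x) (C * l).
Proof. by move=> fP; exact: (@is_deriveZ _ _ _ f C t 1 l). Qed.

(** The mean value inequality on ]x, s[, in the limit where x tends to 0. *)
Lemma norm_le_linear f df C c :
  (forall t, 0 < t < c -> is_derive t (1 : R) f (df t)) ->
  (forall t, 0 < t < c -> `|df t| <= C) ->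
  f x @[x --> 0^'+] --> (0 : R) ->
  forall s, 0 < s < c -> `|f s| <= C * s.
Proof.
move=> fP dfC f0 s /andP[s0 sc].
have C0 : 0 <= C by apply: le_trans (dfC s _); rewrite ?s0.
have fs : `|f s - f x| @[x --> 0^'+] --> `|f s - 0|.
  by apply: cvg_norm; apply: cvgB => //; exact: cvg_cst.
rewrite subr0 in fs.
rewrite -(cvg_lim _ fs) //; apply: limr_le; first by apply/cvg_ex; eexists; exact: fs.
near=> x.
have x0 : 0 < x by near: x; exact: nbhs_right_gt.
have xs : x < s by near: x; exact: nbhs_right_lt.
apply: (le_trans (y := C * s - C * x)); last first.
  by rewrite gerBl mulr_ge0 // ltW.
apply: (@is_derive_bound f df (fun t => C * t) (fun=> C) 0 c) => //; last exact: ltW.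
move=> t _; rewrite -[X in is_derive _ _ _ X]mulr1.
exact: (is_deriveMl C (is_derive_id t 1)).
Unshelve. all: by end_near. Qed.

End RealAnalysis.

Section FTC.
Variable R : realType.
Notation mu := (@lebesgue_measure R).

(** The integrand may be unbounded at both ends: this is the case of the outermost
    integral of [omega], whose integrand has logarithms at 0. The usual theorem
    is applied on an increasing sequence of segments, and the limit is taken by
    monotone convergence. *)
Lemma ge0_FTC2_oo (f F : R -> R) (a b A B : R) : a < b ->
  (forall t, a < t < b -> is_derive t (1 : R) F (f t)) ->
  (forall t, a < t < b -> {for t, continuous f}) ->
  (forall t, a < t < b -> 0 <= f t) ->
  F x @[x --> a^'+] --> A -> F x @[x --> b^'-] --> B ->
  (\int[mu]_(x in `]a, b[) (f x)%:E = (B - A)%:E)%E.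
Proof.
move=> ab FP fc f0 FA FB.
(* With [n.+3], the segment is never empty. *)
pose e n := (b - a) / n.+3%:R.
have e0 n : 0 < e n by rewrite divr_gt0 ?subr_gt0.
have cvge : e @ \oo --> (0 : R).
  rewrite -[X in _ --> X](mulr0 (b - a)); apply: cvgM; first exact: cvg_cst.
  have := @cvg_harmonic R; rewrite -(cvg_shiftn 2); apply: cvg_trans.
  apply: near_eq_cvg; apply: nearW => n; rewrite /harmonic /=.
  by rewrite addn2.
pose u n := a + e n; pose v n := b - e n.
have uv n : u n < v n.
  have eE : e n *+ n.+3 = b - a by rewrite -mulr_natr divfK.
  have : e n *+ 2 < e n *+ n.+3 by rewrite ltr_pMn2l.
  by rewrite eE /u /v mulr2n; lra.
have ule n m : (n <= m)%N -> e m <= e n.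
  move=> nm; rewrite /e ler_pM2l ?subr_gt0 // lef_pV2 ?posrE ?ltr0n // ler_nat.
  by rewrite !ltnS.
have sub n x : `[u n, v n]%classic x -> a < x < b.
  rewrite /= in_itv /= /u /v => /andP[ux xv].
  by rewrite (lt_le_trans _ ux) ?ltrDl ?e0 //= (le_lt_trans xv) // gtrBl.
have cup : \bigcup_n `[u n, v n]%classic = `]a, b[%classic.
  apply/seteqP; split=> [x [n _ /sub]|x]; first by rewrite /= in_itv.
  rewrite /= in_itv /= => /andP[ax xb].
  have [n ne] : exists n, e n < Num.min (x - a) (b - x).
    have : 0 < Num.min (x - a) (b - x) by rewrite lt_min !subr_gt0 ax xb.
    move=> mp; have := cvge; move/cvgrPdist_lt => /(_ _ mp)[n _ /(_ n (leqnn n))].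
    by rewrite /= sub0r normrN gtr0_norm // => ?; exists n.
  exists n => //=; rewrite in_itv /= /u /v.
  by move: ne; rewrite lt_min => /andP[? ?]; apply/andP; split; lra.
have mf : measurable_fun `]a, b[ f.
  apply: open_continuous_measurable_fun; first exact: interval_open.
  by move=> x; rewrite inE /= in_itv /= => /fc.
have lim1 : (\int[mu]_(x in `[u n, v n]) (f x)%:E)%E @[n --> \oo] -->
    (\int[mu]_(x in `]a, b[) (f x)%:E)%E.
  rewrite -cup; apply: ge0_nondecreasing_set_cvg_integral.
  - move=> n m nm; apply/subsetPset => x; rewrite /= !in_itv /= /u /v => /andP[ux xv].
    rewrite (le_trans _ ux) ?lerD2l ?ule //= (le_trans xv) // lerD2l lerN2 ule //.
  - by move=> n; exact: measurable_itv.
  - move=> n; apply/measurable_EFinP; apply: measurable_funS mf => //.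
    by move=> x /sub; rewrite /= in_itv.
  - by move=> n x /sub; rewrite lee_fin; apply: f0.
have lim2 : (\int[mu]_(x in `[u n, v n]) (f x)%:E)%E @[n --> \oo] --> (B - A)%:E.
  have -> : (fun n => \int[mu]_(x in `[u n, v n]) (f x)%:E)%E =
      (fun n => (F (v n) - F (u n))%:E).
    apply/funext => n; rewrite (@continuous_FTC2 _ f F) //.
    - apply: continuous_in_subspaceT => x; rewrite inE => /sub; exact: fc.
    - have Fc x : u n <= x <= v n -> {for x, continuous F}.
        move=> xuv; apply: is_derive_continuous; apply: FP; apply: (sub n).
        by rewrite /= in_itv.
      split.
      + move=> x; rewrite in_itv /= => /andP[ux xv].
        by have [] := FP x (sub n x _) => //; rewrite /= in_itv /= !ltW.
      + by apply/cvg_at_right_filter/Fc; rewrite lexx ltW.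
      + by apply/cvg_at_left_filter/Fc; rewrite lexx ltW.
    - move=> x; rewrite in_itv /= => /andP[ux xv].
      have [] := FP x (sub n x _); first by rewrite /= in_itv /= !ltW.
      by move=> _ Fx; rewrite derive1E Fx.
  apply: cvg_EFin; first exact: nearW.
  apply: cvgB.
    have /cvg_at_leftP := FB; apply; split=> [n|]; first by rewrite /v gtrBl.
    by rewrite -[X in _ --> X]subr0; apply: cvgB => //; exact: cvg_cst.
  have /cvg_at_rightP := FA; apply; split=> [n|]; first by rewrite /u ltrDl.
  by rewrite -[X in _ --> X]addr0; apply: cvgD => //; exact: cvg_cst.
exact: (cvg_unique _ lim1 lim2).
Qed.

End FTC.

Section IntegralPrimitive.
Variable R : realType.
Notation mu := (@lebesgue_measure R).

Lemma integral_oo (f : R -> \bar R) (g : R -> R) (a b : R) :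
  a < b -> measurable_fun `]a, b[ g ->
  (forall t, a < t < b -> f t = (g t)%:E) ->
  (forall t, t < a -> f t = 0%E) -> (forall t, b < t -> f t = 0%E) ->
  (\int[mu]_t f t = \int[mu]_(t in `]a, b[) (g t)%:E)%E.
Proof.
move=> ab mg fg fa fb.
have mf : measurable_fun `]a, b[ f.
  apply: (@eq_measurable_fun _ _ _ _ _ (EFin \o g)); last exact/measurable_EFinP.
  by move=> t; rewrite inE /= in_itv /= => /fg ->.
transitivity (\int[mu]_(t in `[a, b]) f t)%E.
  rewrite [RHS]integral_mkcond; apply: eq_integral => t _; rewrite patchE.
  case: ifPn => // /negP; rewrite inE /= in_itv /= => /negP.
  by rewrite negb_and -!ltNge => /orP[/fa|/fb].
rewrite -integral_itv_obnd_cbnd; last first.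
  rewrite -(setUitv1 true) ?bnd_simp //; apply/measurable_funU => //.
  by split => //; exact: measurable_fun_set1.
rewrite -integral_itv_bndo_bndc //; apply: eq_integral => t.
by rewrite inE /= in_itv /= => /fg.
Qed.

(** The values of [f] at [a] and [b] are arbitrary, as the inner integral of an
    iterated integral may be infinite at the ends of the range of the outer
    variable. *)
Lemma integral_primitive (f : R -> \bar R) (g G : R -> R) (a b A B : R) :
  a < b ->
  (forall t, a < t < b -> is_derive t (1 : R) G (g t)) ->
  (forall t, a < t < b -> {for t, continuous g}) ->
  (exists n, forall t, a < t < b -> 0 <= (-1) ^+ n * g t) ->
  G x @[x --> a^'+] --> A -> G x @[x --> b^'-] --> B ->
  (forall t, a < t < b -> f t = (g t)%:E) ->
  (forall t, t < a -> f t = 0%E) -> (forall t, b < t -> f t = 0%E) ->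
  (\int[mu]_t f t = (B - A)%:E)%E.
Proof.
move=> ab Gg gc [n sg] GA GB fg fa fb.
rewrite (@integral_oo f g a b) //; last first.
  apply: open_continuous_measurable_fun; first exact: interval_open.
  by move=> x; rewrite inE /= in_itv /= => /gc.
move: sg; rewrite -signr_odd; case: (odd n) => sg; last first.
  by apply: (ge0_FTC2_oo (F := G)) => // t /sg; rewrite mul1r.
have -> : (\int[mu]_(t in `]a, b[) (g t)%:E)%E =
    (- \int[mu]_(t in `]a, b[) (- g t)%:E)%E.
  rewrite -integral_ge0N; last first.
    by move=> t; rewrite /= in_itv lee_fin => /sg; rewrite mulN1r.
  by apply: eq_integral => t _; rewrite EFinN oppeK.
have E : (\int[mu]_(t in `]a, b[) (- g t)%:E = (- B - - A)%R%:E)%E.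
  apply: (ge0_FTC2_oo (f := fun t => - g t) (F := fun t => - G t) ab _ _ _
    (cvgN GA) (cvgN GB)).
  - by move=> t /Gg Gt; exact: is_deriveN.
  - by move=> t /gc gt; exact: continuousN.
  - by move=> t /sg; rewrite mulN1r.
by rewrite E -EFinN opprB opprK addrC.
Qed.

End IntegralPrimitive.

Local Open Scope complex_scope.

(** * Real and imaginary parts *)

Section ComplexParts.
Variable R : realType.
Notation C := (R[i]).

Lemma normc_ge_Im (z : C) : `|complex.Im z|%:C <= `|z|.
Proof.
by rewrite normc_def lecR -sqrtr_sqr ler_wsqrtr // lerDr sqr_ge0.
Qed.

Lemma cvg_lipschitz (p : C -> R) (T : Type) (F : set_system T) {FF : Filter F}
    (f : T -> C) (l : C) :
  (forall y z, `|p y - p z|%:C <= `|y - z|) ->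
  (f x : C^o) @[x --> F] --> (l : C^o) -> p (f x) @[x --> F] --> p l.
Proof.
move=> lip /cvgrPdist_lt fl; apply/cvgrPdist_lt => e e0.
have e0' : (0 : C) < e%:C by rewrite ltcR.
by apply: filterS (fl _ e0') => x; rewrite -ltcR; apply: le_lt_trans.
Qed.

Lemma cvg_Re (T : Type) (F : set_system T) {FF : Filter F} (f : T -> C) (l : C) :
  (f x : C^o) @[x --> F] --> (l : C^o) ->
  complex.Re (f x) @[x --> F] --> complex.Re l.
Proof.
apply: cvg_lipschitz => y z; apply: le_trans (normc_ge_Re _).
by rewrite lecR; case: y z => [u v] [u' v'].
Qed.

Lemma cvg_Im (T : Type) (F : set_system T) {FF : Filter F} (f : T -> C) (l : C) :
  (f x : C^o) @[x --> F] --> (l : C^o) ->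
  complex.Im (f x) @[x --> F] --> complex.Im l.
Proof.
apply: cvg_lipschitz => y z; apply: le_trans (normc_ge_Im _).
by rewrite lecR; case: y z => [u v] [u' v'].
Qed.

Lemma Re_mulrC (z : C) (r : R) : complex.Re (z * r%:C) = complex.Re z * r.
Proof. by case: z => u v /=; rewrite mulr0 subr0. Qed.

Lemma Im_mulrC (z : C) (r : R) : complex.Im (z * r%:C) = complex.Im z * r.
Proof. by case: z => u v /=; rewrite mulr0 add0r. Qed.

Lemma is_derive_of_quotient (f : R -> R) (z l : R) :
  h^-1 * (f (z + h) - f z) @[h --> 0^'] --> l -> is_derive z (1 : R) f l.
Proof.
move=> fl.
have E : (fun h : R => h^-1 *: ((f \o shift z) (h *: 1) - f z)) =
         (fun h => h^-1 * (f (z + h) - f z)).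
  by apply/funext => h; rewrite /= /GRing.scale /= mulr1 [h + z]addrC.
split; first by rewrite /derivable E; apply/cvg_ex; exists l.
by rewrite /derive E; apply/cvg_lim.
Qed.

Lemma has_deriv_Re (f : R -> C) z l : has_deriv f z l ->
  is_derive z (1 : R) (fun t => complex.Re (f t)) (complex.Re l).
Proof.
move=> /cvg_Re fl; apply: is_derive_of_quotient; move: fl.
apply: cvg_trans; apply: near_eq_cvg; apply: nearW => h.
rewrite mulrC Re_mulrC mulrC; congr (_ * _).
by case: (f _) (f _) => [? ?] [? ?].
Qed.

Lemma has_deriv_Im (f : R -> C) z l : has_deriv f z l ->
  is_derive z (1 : R) (fun t => complex.Im (f t)) (complex.Im l).
Proof.
move=> /cvg_Im fl; apply: is_derive_of_quotient; move: fl.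
apply: cvg_trans; apply: near_eq_cvg; apply: nearW => h.
rewrite mulrC Im_mulrC mulrC; congr (_ * _).
by case: (f _) (f _) => [? ?] [? ?].
Qed.

End ComplexParts.

(** * Solutions of the KZ system *)

Section KZSystem.
Variable R : realType.
Local Notation form := Defs.form.
Local Notation series := (ncseries bool R).
Implicit Types (g k e : R -> series) (w u v : seq bool) (s t z : R).

(** The KZ equation, read on the coefficients. *)
Definition KZ_system g : Prop := forall w z, 0 < z < 1 ->
  is_derive z (1 : R) (fun t => g t w)
    (if w is x :: v then form x z * g z v else 0).

Lemma cvg_bigsum (I : Type) (r : seq I) (T : Type) (F : set_system T)
    {FF : Filter F} (f : I -> T -> R) (l : I -> R) :
  (forall i, f i x @[x --> F] --> l i) ->
  \sum_(i <- r) f i x @[x --> F] --> \sum_(i <- r) l i.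
Proof.
move=> fl; elim: r => [|i r IHr].
  by under eq_fun do rewrite big_nil; rewrite big_nil; exact: cvg_cst.
under eq_fun do rewrite big_cons; rewrite big_cons.
by apply: cvgD => //; exact: fl.
Qed.

Lemma is_derive_bigsum (I : Type) (r : seq I) (f : I -> R -> R) (l : I -> R) z :
  (forall i, is_derive z (1 : R) (f i) (l i)) ->
  is_derive z (1 : R) (fun t => \sum_(i <- r) f i t) (\sum_(i <- r) l i).
Proof.
move=> fl; elim: r => [|i r IHr].
  by under eq_fun do rewrite big_nil; rewrite big_nil; exact: is_derive_cst.
under eq_fun do rewrite big_cons; rewrite big_cons.
exact: is_deriveD.
Qed.

Lemma cvg_cst_eq (F : set_system R) {FF : ProperFilter F} (f : R -> R) (c l : R) :
  F `]0, 1[%classic -> (forall z, 0 < z < 1 -> f z = c) ->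
  f z @[z --> F] --> l -> c = l.
Proof.
move=> F01 fc fl; have fc' : f z @[z --> F] --> c.
  apply: cvg_near_cst; by apply: filterS F01 => z; rewrite /= in_itv /= => /fc ->.
exact: (cvg_unique _ fc' fl).
Qed.

Lemma is_derive0_cst01 (f : R -> R) :
  (forall t, 0 < t < 1 -> is_derive t (1 : R) f 0) ->
  forall z, 0 < z < 1 -> f z = f 2^-1.
Proof. by move=> f0 z z01; apply: (is_derive0_cst f0) => //; lra. Qed.

Section Asymptotics.
Variables (F : set_system R).
Context {FF : ProperFilter F}.
Hypothesis F01 : F `]0, 1[%classic.

(** If [k] vanishes on the words shorter than [w], then the coefficient at [w]
    is constant and equal to that of [k z * e z], which tends to 0. *)
Lemma KZ_system_eq0 k e : KZ_system k -> (forall z, e z [::] = 1) ->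
  (forall w, (k z * e z) w @[z --> F] --> (0 : R)) ->
  forall w z, 0 < z < 1 -> k z w = 0.
Proof.
move=> kP e1 k0 w; have [n] := ubnP (size w); elim: n w => // n IHn w lt_w.
have kcst z : 0 < z < 1 -> k z w = k (2^-1) w.
  apply: (is_derive0_cst01 (f := fun t => k t w)) => t t01.
  have := kP w t t01; case: w lt_w => // x v lt_v.
  by rewrite IHn // mulr0.
move=> z z01; rewrite kcst //.
apply: (@cvg_cst_eq F _ (fun z => (k z * e z) w)) (k0 w) => // t t01.
rewrite nccoefM big_ord_recr /= take_size drop_size e1 mulr1 kcst //.
rewrite big1 ?add0r // => i _; rewrite IHn ?mul0r // size_take_min.
by rewrite (leq_ltn_trans (geq_minl _ _)) // (leq_trans (ltn_ord i)).
Qed.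

(** By induction on [u] and [v], the shuffle defect at [u] and [v] has derivative
    0, hence is constant. By [grouplike_defect] it is the defect of [g z * e z],
    which tends to that of 1. *)
Lemma KZ_system_grouplike g e : KZ_system g -> (forall z, grouplike (e z)) ->
  (forall w, (g z * e z) w @[z --> F] --> (1 : series) w) ->
  forall z, 0 < z < 1 -> grouplike (g z).
Proof.
move=> gP eP g1.
have gnil z : 0 < z < 1 -> g z [::] = 1.
  move=> z01; have gcst t : 0 < t < 1 -> g t [::] = g (2^-1) [::].
    by apply: (is_derive0_cst01 (f := fun t => g t [::])); exact: (gP [::]).
  rewrite gcst //; apply: (@cvg_cst_eq F _ (fun z => (g z * e z) [::])) (g1 [::]) => //.
  by move=> t t01; rewrite nccoefM_nil (eP t).1 mulr1 gcst.
move=> z z01; split=> [|u v]; first exact: gnil.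
move: z z01; have [n] := ubnP (size u + size v); elim: n u v => // n IHn u v lt_n.
pose d t := coprod (g t) u v - g t u * g t v.
suff d0 z : 0 < z < 1 -> d z = 0 by move=> z /d0/eqP; rewrite subr_eq0 => /eqP.
have dcst t : 0 < t < 1 -> d t = d (2^-1).
  apply: (is_derive0_cst01 (f := d)) => {}t t01; rewrite /d.
  case: u lt_n {d} => [|x u] lt_n.
    have -> : (fun t => coprod (g t) [::] v - g t [::] * g t v) =
              (fun t => g t v - g t [::] * g t v).
      by apply/funext => s; rewrite coprod0s.
    have := is_deriveB (gP v t t01) (is_deriveM (gP [::] t t01) (gP v t t01)).
    move/is_derive_eq; apply; rewrite gnil // scale1r.
    by rewrite scaler0 addr0 subrr.
  case: v lt_n => [|y v] lt_n.
    have -> : (fun t => coprod (g t) (x :: u) [::] - g t (x :: u) * g t [::]) =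
              (fun t => g t (x :: u) - g t (x :: u) * g t [::]).
      by apply/funext => s; rewrite coprods0.
    have := is_deriveB (gP (x :: u) t t01)
              (is_deriveM (gP (x :: u) t t01) (gP [::] t t01)).
    move/is_derive_eq; apply; rewrite gnil // scaler0 add0r scale1r.
    by rewrite subrr.
  have dcop : is_derive t (1 : R) (fun t => coprod (g t) (x :: u) (y :: v))
     (form x t * coprod (g t) u (y :: v) + form y t * coprod (g t) (x :: u) v).
    have -> : (fun t => coprod (g t) (x :: u) (y :: v)) =
      (fun t => \sum_(w <- shuffles u (y :: v)) g t (x :: w) +
                \sum_(w <- shuffles (x :: u) v) g t (y :: w)).
      by apply/funext => s; rewrite coprod_cons.
    rewrite /coprod !mulr_sumr; apply: is_deriveD; apply: is_derive_bigsum => w.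
      exact: (gP (x :: w)).
    exact: (gP (y :: w)).
  have := is_deriveB dcop (is_deriveM (gP (x :: u) t t01) (gP (y :: v) t t01)).
  move/is_derive_eq; apply; have lt1 : (size u + size (y :: v) < n)%N by [].
  have lt2 : (size (x :: u) + size v < n)%N by rewrite -ltnS -addnS.
  rewrite !IHn //; rewrite /GRing.scale /=; ring.
move=> z01; rewrite dcst //.
have dlim : coprod (g z * e z) u v - (g z * e z) u * (g z * e z) v @[z --> F] -->
    coprod (1 : series) u v - (1 : series) u * (1 : series) v.
  by apply: cvgB; [exact: cvg_bigsum|exact: cvgM].
have -> : (0 : R) = coprod (1 : series) u v - (1 : series) u * (1 : series) v.
  by rewrite (grouplike1 _ _).2 subrr.
apply: (@cvg_cst_eq F _ _ _ _ _ _ dlim) => // t t01.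
rewrite grouplike_defect => [|//|u1 v1 lt1]; first exact: dcst.
by apply: IHn => //; apply: leq_trans lt1 _; rewrite -ltnS.
Qed.

Lemma KZ_system_letter g e (L : R -> R) x : KZ_system g ->
  (forall z, 0 < z < 1 -> g z [::] = 1) -> (forall z, e z [::] = 1) ->
  (forall w, (g z * e z) w @[z --> F] --> (1 : series) w) ->
  (forall z, 0 < z < 1 -> is_derive z (1 : R) L (form x z)) ->
  L z + e z [:: x] @[z --> F] --> 0 ->
  forall z, 0 < z < 1 -> g z [:: x] = L z.
Proof.
move=> gP gnil e1 g1 LP L0 z z01; apply/eqP; rewrite -subr_eq0; apply/eqP.
have dcst t : 0 < t < 1 -> g t [:: x] - L t = g (2^-1) [:: x] - L (2^-1).
  apply: (is_derive0_cst01 (f := fun t => g t [:: x] - L t)) => {}t t01.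
  have := is_deriveB (gP [:: x] t t01) (LP t t01).
  by move/is_derive_eq; apply; rewrite gnil // mulr1 subrr.
rewrite dcst //; apply: (@cvg_cst_eq F _
   (fun z => (g z * e z) [:: x] - (L z + e z [:: x]))) => //.
  move=> t t01; rewrite -(dcst t t01) nccoefM !big_ord_recr big_ord0 /=.
  by rewrite gnil // e1 mul1r add0r mulr1; ring.
by rewrite -[X in _ --> X](subrr (0 : R)); apply: cvgB => //; exact: (g1 [:: x]).
Qed.

End Asymptotics.

End KZSystem.

(** * Reduction of the associator to real group-like series *)

Section RealForm.
Variable R : realType.
Local Notation form := Defs.form.
Local Notation C := (R[i]).
Local Notation series := (ncseries bool R).
Implicit Types (g : R -> series) (w u v : seq bool) (s t z : R).

Definition ncseriesC (f : series) : ncseries bool C := NCSeries (fun w => (f w)%:C).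

Lemma ncseriesCE (f : series) w : ncseriesC f w = (f w)%:C.
Proof. by []. Qed.

Lemma ncseriesCM (f h : series) : ncseriesC (f * h) = ncseriesC f * ncseriesC h.
Proof.
apply: ncseriesP => w; rewrite [RHS]nccoefM /= rmorph_sum.
by apply: eq_bigr => k _; rewrite rmorphM.
Qed.

Lemma ncseriesC1 : ncseriesC 1 = 1.
Proof. by apply: ncseriesP => w; rewrite /= rmorph_nat. Qed.

Lemma ncseriesC_inj : injective ncseriesC.
Proof.
move=> f h fh; apply: ncseriesP => w.
by have /(congr1 (fun F : ncseries bool C => complex.Re (F w))) := fh.
Qed.

Lemma grouplike_ncseriesC (f : series) : grouplike f -> grouplike (ncseriesC f).
Proof.
move=> [f1 fP]; split=> [|u v]; first by rewrite /= f1.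
by rewrite /= -rmorphM -fP /coprod rmorph_sum.
Qed.

Definition letter_exp (c : R) (x : bool) : series := ncexp (c *: ncvar x).

Lemma letter_exp_nil c x : letter_exp c x [::] = 1.
Proof. by case: (grouplike_ncexp c x). Qed.

Lemma letter_exp_letter c x y : letter_exp c x [:: y] = (y == x)%:R * c.
Proof.
rewrite /letter_exp ncexp_var /= andbT; case: eqP => _; rewrite ?mul0r //.
by rewrite mul1r divr1 expr1.
Qed.

(** The regularizing factor only involves powers of [x], so it has no effect on
    the coefficients at words that do not end with [x]. *)
Lemma mul_letter_exp_rcons (f : series) c x v y : y != x ->
  (f * letter_exp c x) (rcons v y) = f (rcons v y).
Proof.
move=> yx; have := letter_exp_nil c x.
have eE u : letter_exp c x (rcons u y) = 0.
  by rewrite /letter_exp ncexp_var all_rcons /= (negPf yx).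
move: eE; set e := letter_exp c x; clearbody e => eE e1.
rewrite nccoefM big_ord_recr /= drop_size take_size e1 mulr1.
rewrite big1 ?add0r // => k _; rewrite drop_rcons ?eE ?mulr0 //.
by rewrite -ltnS -(size_rcons v y) ltn_ord.
Qed.

Lemma ncpow_letterE (x : R) (b : bool) :
  ncpow x (- (ncvar b : ncseries bool C)) = ncseriesC (letter_exp (- ln x) b).
Proof.
apply: ncseriesP => w; rewrite /ncpow scalerN -scaleNr -rmorphN.
rewrite ncexp_var /= -/(ncexp _) -[nccoef _ w]/(letter_exp (- ln x) b w).
rewrite /letter_exp ncexp_var; case: all; last by rewrite rmorph0.
by rewrite rmorphM /= rmorphXn fmorphV rmorph_nat.
Qed.

Lemma KZ_operator_coef (c d : C) (f : ncseries bool C) w :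
  ((c *: ncvar false + d *: ncvar true) * f) w =
  if w is x :: v then (if x then d else c) * f v else 0.
Proof.
case: w => [|x v]; first by rewrite nccoefM_nil /= !mulr0 addr0 mul0r.
rewrite nccoefM_cons [X in X * _ + _]/= !mulr0 addr0 mul0r add0r.
have -> : lder x (c *: ncvar false + d *: ncvar true) = (if x then d else c) *: 1.
  apply: ncseriesP => u; rewrite nccoefZ nccoef1 /= eqseq_cons.
  by rewrite eqseq_cons; case: x; rewrite /= ?mulr0 ?addr0 ?add0r.
by rewrite -scalerAl mul1r nccoefZ.
Qed.

Definition Re_series (f : ncseries bool C) : series :=
  NCSeries (fun w => complex.Re (f w)).
Definition Im_series (f : ncseries bool C) : series :=
  NCSeries (fun w => complex.Im (f w)).

Lemma Re_seriesM (f : ncseries bool C) (h : series) :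
  Re_series (f * ncseriesC h) = Re_series f * h.
Proof.
apply: ncseriesP => w; rewrite [RHS]nccoefM /= raddf_sum.
by apply: eq_bigr => k _; exact: Re_mulrC.
Qed.

Lemma Im_seriesM (f : ncseries bool C) (h : series) :
  Im_series (f * ncseriesC h) = Im_series f * h.
Proof.
apply: ncseriesP => w; rewrite [RHS]nccoefM /= raddf_sum.
by apply: eq_bigr => k _; exact: Im_mulrC.
Qed.

Lemma KZ_solution_coef (G : R -> ncseries bool C) : KZ_solution G ->
  forall w z, 0 < z < 1 -> has_deriv (fun t => G t w) z
    (if w is x :: v then (form x z)%:C * G z v else 0).
Proof.
move=> [_ GP] w z z01.
suff <- : (((z^-1)%:C *: ncvar false + ((z - 1)^-1)%:C *: ncvar true) * G z) w =
    (if w is x :: v then (form x z)%:C * G z v else 0) by exact: GP.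
by apply: etrans (KZ_operator_coef _ _ _ _) _; case: w => // -[].
Qed.

Lemma Re_KZ_system (G : R -> ncseries bool C) : KZ_solution G ->
  KZ_system (fun z => Re_series (G z)).
Proof.
move=> /KZ_solution_coef GP w z z01; have := has_deriv_Re (GP w z z01).
by case: w => // x v /=; rewrite mulrC Re_mulrC mulrC.
Qed.

Lemma Im_KZ_system (G : R -> ncseries bool C) : KZ_solution G ->
  KZ_system (fun z => Im_series (G z)).
Proof.
move=> /KZ_solution_coef GP w z z01; have := has_deriv_Im (GP w z z01).
by case: w => // x v /=; rewrite mulrC Im_mulrC mulrC.
Qed.

(** The forms dt/t and dt/(t-1) are real, so that the imaginary part of a solution
    is a solution, with zero asymptotics. *)
Lemma KZ_solution_real (F : set_system R) {FF : ProperFilter F}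
    (G : R -> ncseries bool C) (e : R -> series) :
  F `]0, 1[%classic -> KZ_solution G -> (forall z, e z [::] = 1) ->
  (forall w, ((G z * ncseriesC (e z)) w : C^o) @[z --> F] -->
             ((1 : ncseries bool C) w : C^o)) ->
  [/\ KZ_system (fun z => Re_series (G z)),
      forall w, (Re_series (G z) * e z) w @[z --> F] --> (1 : series) w &
      forall z, 0 < z < 1 -> G z = ncseriesC (Re_series (G z))].
Proof.
move=> F01 GP e1 Glim; split; first exact: Re_KZ_system.
  move=> w; have /(_ _) := @cvg_Re R _ F _ _ _ (Glim w); rewrite !nccoef1.
  have -> : complex.Re ((w == [::])%:R : C) = (w == [::])%:R by case: eqP.
  have -> : (fun z => complex.Re ((G z * ncseriesC (e z)) w)) =
            (fun z => (Re_series (G z) * e z) w).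
    by apply/funext => z; rewrite -Re_seriesM.
  by apply.
move=> z z01; apply: ncseriesP => w /=.
have Im0 : Im_series (G z) w = 0.
  apply: (KZ_system_eq0 F01 (Im_KZ_system GP) e1) => // v.
  have /(_ _) := @cvg_Im R _ F _ _ _ (Glim v); rewrite nccoef1.
  have -> : complex.Im ((v == [::])%:R : C) = 0 by case: eqP.
  have -> : (fun z => complex.Im ((G z * ncseriesC (e z)) v)) =
            (fun z => (Im_series (G z) * e z) v).
    by apply/funext => t; rewrite -Im_seriesM.
  by apply.
by move: Im0; rewrite /=; case: (G z w) => a b /= ->.
Qed.

Lemma at_right0_01 : (0 : R)^'+ `]0, 1[%classic.
Proof.
near=> z; rewrite /= in_itv /=; apply/andP; split; near: z.
  exact: nbhs_right_gt.
exact: nbhs_right_lt.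
Unshelve. all: by end_near. Qed.

Lemma at_left1_01 : (1 : R)^'- `]0, 1[%classic.
Proof.
near=> z; rewrite /= in_itv /=; apply/andP; split; near: z.
  exact: nbhs_left_gt.
exact: nbhs_left_lt.
Unshelve. all: by end_near. Qed.

(** [exp0 z] and [exp1 z] are the factors z^(-A_0) and (1 - z)^(-A_1) of the
    asymptotic conditions. *)
Definition exp0 (z : R) : series := letter_exp (- ln z) false.
Definition exp1 (z : R) : series := letter_exp (- ln (1 - z)) true.

Record real_KZ_pair (g0 g1 : R -> series) : Prop := RealKZPair {
  kz0 : KZ_system g0;
  kz1 : KZ_system g1;
  lim0 : forall w, (g0 z * exp0 z) w @[z --> 0^'+] --> (1 : series) w;
  lim1 : forall w, (g1 z * exp1 z) w @[z --> 1^'-] --> (1 : series) w }.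

Lemma KZ_associator_real Phi : is_KZ_associator Phi ->
  exists g0 g1, real_KZ_pair g0 g1 /\
    forall z, 0 < z < 1 -> Phi = (ncseriesC (g1 z))^-1 * ncseriesC (g0 z).
Proof.
move=> [G0 [G1 [GP0 G0lim GP1 G1lim PhiE]]].
have exp0E z : ncseriesC (exp0 z) = ncpow z (- ncvar false).
  by rewrite ncpow_letterE.
have exp1E z : ncseriesC (exp1 z) = ncpow (1 - z) (- ncvar true).
  by rewrite ncpow_letterE.
have lim0 w : ((G0 z * ncseriesC (exp0 z)) w : C^o) @[z --> 0^'+] -->
    ((1 : ncseries bool C) w : C^o).
  have -> : (fun z => (G0 z * ncseriesC (exp0 z)) w) =
    (fun z => (G0 z * ncpow z (- ncvar false)) w).
    by apply/funext => z; rewrite exp0E.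
  exact: G0lim.
have lim1 w : ((G1 z * ncseriesC (exp1 z)) w : C^o) @[z --> 1^'-] -->
    ((1 : ncseries bool C) w : C^o).
  have -> : (fun z => (G1 z * ncseriesC (exp1 z)) w) =
    (fun z => (G1 z * ncpow (1 - z) (- ncvar true)) w).
    by apply/funext => z; rewrite exp1E.
  exact: G1lim.
have [kz0 rlim0 G0E] := KZ_solution_real at_right0_01 GP0
  (fun z => letter_exp_nil (- ln z) false) lim0.
have [kz1 rlim1 G1E] := KZ_solution_real at_left1_01 GP1
  (fun z => letter_exp_nil (- ln (1 - z)) true) lim1.
exists (fun z => Re_series (G0 z)), (fun z => Re_series (G1 z)); split.
  exact: (RealKZPair kz0 kz1 rlim0 rlim1).
by move=> z z01; rewrite -G0E // -G1E // -PhiE.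
Qed.

Section Associator.
Variables (g0 g1 : R -> series).
Hypothesis g01 : real_KZ_pair g0 g1.

Lemma grouplike_g0 z : 0 < z < 1 -> grouplike (g0 z).
Proof.
apply: (KZ_system_grouplike at_right0_01 (kz0 g01) _ (lim0 g01)) => s.
exact: grouplike_ncexp.
Qed.

Lemma grouplike_g1 z : 0 < z < 1 -> grouplike (g1 z).
Proof.
apply: (KZ_system_grouplike at_left1_01 (kz1 g01) _ (lim1 g01)) => s.
exact: grouplike_ncexp.
Qed.

Lemma antipode_inv z : 0 < z < 1 -> (g1 z)^-1 = antipode (g1 z).
Proof.
move=> z01; have Gg := grouplike_g1 z01.
by rewrite -[LHS]mul1r -(antipodeM Gg) mulrK // ncseries_unit // Gg.1.
Qed.

(** The quotient of the two solutions, taken at one point; when the two solutions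
    define an associator, it is the same at all points of ]0, 1[. *)
Definition real_associator : series := antipode (g1 2^-1) * g0 2^-1.

Lemma half_in01 : 0 < (2^-1 : R) < 1. Proof. by lra. Qed.

Lemma g1_real_associator : g1 2^-1 * real_associator = g0 2^-1.
Proof.
have Gg := grouplike_g1 half_in01.
by rewrite /real_associator -(antipode_inv half_in01) mulrA mulrV ?mul1r // ncseries_unit // Gg.1.
Qed.

Lemma grouplike_real_associator : grouplike real_associator.
Proof.
apply: (grouplike_divl (grouplike_g1 half_in01)); rewrite g1_real_associator.
exact: grouplike_g0 half_in01.
Qed.

Lemma ncseriesC_quotient z : 0 < z < 1 ->
  (ncseriesC (g1 z))^-1 * ncseriesC (g0 z) = ncseriesC (antipode (g1 z) * g0 z).
Proof.
move=> z01; have Gg := grouplike_g1 z01; rewrite ncseriesCM; congr (_ * _).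
have := congr1 ncseriesC (antipodeM Gg); rewrite ncseriesCM ncseriesC1 => inv1.
rewrite -[LHS]mul1r -inv1 mulrK // ncseries_unit //.
exact: (grouplike_ncseriesC Gg).1.
Qed.

(** Both coefficients are log z at A_0 and log (1 - z) at A_1. *)
Lemma g0_g1_letter x z : 0 < z < 1 -> g0 z [:: x] = g1 z [:: x].
Proof.
pose L x (z : R) := if x then ln (1 - z) else ln z.
have dln1 (t : R) : t < 1 -> is_derive t (1 : R) (fun s => ln (1 - s)) (t - 1)^-1.
  rewrite -subr_gt0 => t1.
  have d1 := is_deriveB (@is_derive_cst R R R 1 t 1) (is_derive_id t 1).
  have := @is_derive1_comp R (@ln R) (fun s => 1 - s) t _ _ (is_derive1_ln t1) d1.
  by rewrite sub0r mulrN1 -invrN opprB.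
have dL y t : 0 < t < 1 -> is_derive t (1 : R) (L y) (form y t).
  move=> /andP[t0 t1]; rewrite /L /form; case: y; first exact: dln1.
  exact: is_derive1_ln.
have ln1r : ln (1 - t) @[t --> (0 : R)^'+] --> (0 : R).
  have /cvg_at_right_filter := is_derive_continuous (dln1 0 ltr01).
  by rewrite subr0 ln1.
have ln1l : ln t @[t --> (1 : R)^'-] --> (0 : R).
  have /cvg_at_left_filter := is_derive_continuous (is_derive1_ln (@ltr01 R)).
  by rewrite ln1.
move=> z01; transitivity (L x z).
  apply: (KZ_system_letter at_right0_01 (kz0 g01) _ _ (lim0 g01) (dL x)) z01.
  - by move=> t t01; exact: (grouplike_g0 t01).1.
  - by move=> t; exact: letter_exp_nil.
  rewrite /exp0; under eq_fun do rewrite letter_exp_letter.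
  case: x; rewrite /L /=.
    by under eq_fun do rewrite mul0r addr0.
  by under eq_fun do rewrite mul1r subrr; exact: cvg_cst.
apply/esym; move: z01.
apply: (KZ_system_letter at_left1_01 (kz1 g01) _ _ (lim1 g01) (dL x)).
- by move=> t t01; exact: (grouplike_g1 t01).1.
- by move=> t; exact: letter_exp_nil.
rewrite /exp1; under eq_fun do rewrite letter_exp_letter.
case: x; rewrite /L /=.
  by under eq_fun do rewrite mul1r subrr; exact: cvg_cst.
by under eq_fun do rewrite mul0r addr0.
Qed.

Lemma real_associator_letter x : real_associator [:: x] = 0.
Proof.
have : (g1 2^-1 * real_associator) [:: x] = g0 2^-1 [:: x] by rewrite g1_real_associator.
rewrite (g0_g1_letter x half_in01) nccoefM_cons nccoefM_nil grouplike_real_associator.1 mulr1.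
rewrite (grouplike_g1 half_in01).1 mul1r => /eqP.
by rewrite -subr_eq0 addrK => /eqP.
Qed.

End Associator.

End RealForm.

(** * The coefficients at admissible words are iterated integrals *)

Section Limits.
Variable R : realType.
Local Notation form := Defs.form.
Variables (g0 g1 : R -> ncseries bool R).
Hypothesis g01 : real_KZ_pair g0 g1.
Hypothesis quotientE : forall z, 0 < z < 1 -> antipode (g1 z) * g0 z = real_associator g0 g1.
Implicit Types (a w v : seq bool) (c s t : R).

Lemma form_inv_bound x t : 0 < t < 2^-1 -> `|form x t| <= t^-1.
Proof.
move=> /andP[t0 t2]; case: x; rewrite /form normfV; last by rewrite gtr0_norm.
have -> : `|t - 1| = 1 - t by rewrite ltr0_norm ?opprB; lra.
by rewrite lef_pV2 ?posrE; lra.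
Qed.

(** The bound holds for log (1 - s). A letter added on the left multiplies by a
    form bounded by 1/s, which gives a bounded derivative, hence again O(s). *)
Lemma g0_rcons_true v : exists C, forall s, 0 < s < 2^-1 ->
  `|g0 s (rcons v true)| <= C * s.
Proof.
have g0lim u : g0 s (rcons u true) @[s --> 0^'+] --> (0 : R).
  have := @lim0 _ _ _ g01 (rcons u true).
  have -> : (fun z => (g0 z * exp0 z) (rcons u true)) = (fun z => g0 z (rcons u true)).
    by apply/funext => z; apply: mul_letter_exp_rcons.
  by rewrite nccoef1; case: u.
elim: v => [|x v [C vC]].
  exists 2 => s s2; apply: (@norm_le_linear R (fun t => g0 t [:: true])
    (fun t => form true t * g0 t [::]) 2 2^-1) => //.
  - by move=> t t2; apply: (kz0 g01 [:: true]); lra.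
  - move=> t t2; rewrite (grouplike_g0 g01 _).1 ?mulr1; last by lra.
    have t1 : `|t - 1| = 1 - t by rewrite ltr0_norm ?opprB; lra.
    by rewrite /form normfV t1 -[leRHS]invrK lef_pV2 ?posrE; lra.
  exact: (g0lim [::]).
exists C => s s2; apply: (@norm_le_linear R (fun t => g0 t (x :: rcons v true))
  (fun t => form x t * g0 t (rcons v true)) C 2^-1) => //.
- by move=> t t2; apply: (kz0 g01 (x :: rcons v true)); lra.
- move=> t t2; rewrite normrM.
  apply: (le_trans (ler_pM _ _ (form_inv_bound x t2) (vC t t2))) => //.
  by rewrite mulrCA mulVf ?mulr1 //; lra.
exact: (g0lim (x :: v)).
Qed.

(** This form of o(1/s) is stable under the recursion, whose derivatives are
    bounded by (C + h/t)/t: the term C/t is absorbed by a small multiple of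
    1/t^2, the derivative of -1/t, and a constant. *)
Lemma g1_growth w (e : R) : 0 < e ->
  exists C, forall s, 0 < s < 2^-1 -> `|g1 s w| <= C + e * s^-1.
Proof.
elim: w e => [|x w IHw] e e0.
  exists 1 => s s2; rewrite (grouplike_g1 g01 _).1; last by lra.
  rewrite normr1 lerDl mulr_ge0 ?invr_ge0 //; lra.
pose h := e / 2; have h0 : 0 < h by rewrite /h; lra.
have [C wC] := IHw h h0.
pose D := C ^+ 2 / (4 * h).
have D0 : 0 <= D by rewrite divr_ge0 ?sqr_ge0 // mulr_ge0 // ltW.
pose p : R := 4^-1.
exists (`|g1 p (x :: w)| + 8 * h + D) => s s2.
have dG t : 0 < t < 2^-1 -> is_derive t (1 : R)
    (fun t => - (e * t^-1) + D * t) (e * (t ^+ 2)^-1 + D).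
  move=> t2; have t0 : t != 0 by lra.
  have := is_deriveD (is_deriveMl (- e) (is_deriveV t0 (is_derive_id t (1 : R))))
                     (is_deriveMl D (is_derive_id t (1 : R))).
  rewrite mulr1 /GRing.scale /= mulr1 mulrNN.
  have -> // : (fun x : R => - e * x^-1) + (fun x => D * x) =
            (fun t => - (e * t^-1) + D * t).
  by apply/funext => y; rewrite -mulNr.
have bnd t : 0 < t < 2^-1 -> `|form x t * g1 t w| <= e * (t ^+ 2)^-1 + D.
  move=> t2; rewrite normrM.
  apply: (le_trans (ler_pM _ _ (form_inv_bound x t2) (wC t t2))) => //.
  have t0 : 0 < t by lra.
  (* The inequality of arithmetic and geometric means; it dictates [D]. *)
  have key : C * t^-1 <= h * (t^-1) ^+ 2 + D.
    rewrite /D -subr_ge0.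
    have -> : h * t^-1 ^+ 2 + C ^+ 2 / (4 * h) - C * t^-1 =
              (2 * h * t^-1 - C) ^+ 2 / (4 * h) by field; lra.
    by rewrite divr_ge0 ?sqr_ge0 // mulr_ge0 // ltW.
  have -> : e * (t ^+ 2)^-1 = h * t^-1 ^+ 2 + h * t^-1 ^+ 2.
    by rewrite -exprVn /h; field; lra.
  have -> : t^-1 * (C + h * t^-1) = C * t^-1 + h * t^-1 ^+ 2 by ring.
  by lra.
have dg t : 0 < t < 2^-1 -> is_derive t (1 : R) (fun t => g1 t (x :: w))
    (form x t * g1 t w).
  by move=> t2; apply: (kz1 g01 (x :: w)); lra.
have B := is_derive_bound dg dG bnd.
have s0 : 0 < s by lra.
have is0 : 0 <= e * s^-1 by rewrite divr_ge0 // ltW.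
have pE : p^-1 = 4 by rewrite invrK.
have eh : e = 2 * h by rewrite /h; field.
have [sp|ps] := leP s p.
  have H : `|g1 p (x :: w) - g1 s (x :: w)| <=
     - (e / p) + D * p - (- (e / s) + D * s).
    by apply: B => //; rewrite /p; lra.
  rewrite pE in H.
  have := ler_normB (g1 p (x :: w)) (g1 p (x :: w) - g1 s (x :: w)).
  rewrite opprB addrCA subrr addr0 => H2.
  have Dp : D * p <= D by rewrite ler_piMr // /p; lra.
  have Ds : 0 <= D * s by rewrite mulr_ge0 // ltW.
  by apply: (le_trans H2); lra.
have H : `|g1 s (x :: w) - g1 p (x :: w)| <=
   - (e / s) + D * s - (- (e / p) + D * p).
  by apply: B; rewrite ?(ltW ps) // /p; lra.
rewrite pE in H.
have := ler_normD (g1 p (x :: w)) (g1 s (x :: w) - g1 p (x :: w)).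
rewrite addrCA subrr addr0 => H2.
have Ds : D * s <= D by rewrite ler_piMr //; lra.
have Dp : 0 <= D * p by rewrite mulr_ge0 // /p; lra.
by apply: (le_trans H2); lra.
Qed.

(** The coefficient of [antipode (g1 s)] at the reversal of [a]. *)
Definition signed_g1 a s : R := (-1) ^+ size a * g1 s a.

Lemma signed_g1_nil s : 0 < s < 1 -> signed_g1 [::] s = 1.
Proof. by move=> s01; rewrite /signed_g1 mul1r (grouplike_g1 g01 s01).1. Qed.

Lemma is_derive_signed_g1 (b : bool) a s : 0 < s < 1 ->
  is_derive s (1 : R) (signed_g1 (b :: a)) (- (form b s * signed_g1 a s)).
Proof.
move=> s01; have := is_deriveMl ((-1) ^+ (size a).+1) (kz1 g01 (b :: a) s01).
by move/is_derive_eq; apply; rewrite /signed_g1 exprS mulN1r mulNr mulrCA.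
Qed.

Lemma signed_g1_continuous a s : 0 < s < 1 -> {for s, continuous (signed_g1 a)}.
Proof.
move=> s01; apply: is_derive_continuous.
exact: (is_deriveMl ((-1) ^+ size a) (kz1 g01 a s01)).
Qed.

Lemma signed_g1_at1 a : ~~ last true a -> signed_g1 a s @[s --> 1^'-] --> (0 : R).
Proof.
case: (lastP a) => // {}a x; rewrite last_rcons => /negPf ->.
rewrite -[X in _ --> X](mulr0 ((-1) ^+ size (rcons a false))).
apply: cvgM; first exact: cvg_cst.
have := @lim1 _ _ _ g01 (rcons a false); rewrite nccoef1.
have -> : (fun z => (g1 z * exp1 z) (rcons a false)) = (fun z => g1 z (rcons a false)).
  by apply/funext => z; apply: mul_letter_exp_rcons.
by case: a.
Qed.

Lemma form_sign (b : bool) t : 0 < t < 1 -> 0 < (-1) ^+ b * form b t.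
Proof.
case: b => t01; rewrite /form; last by rewrite mul1r invr_gt0; lra.
by rewrite mulN1r -invrN invr_gt0; lra.
Qed.

(** The forms have constant signs on ]0, 1[, so that each coefficient, normalized
    by these signs, decreases to its limit 0 at 1. *)
Lemma signed_g1_sign a s : ~~ last false a -> 0 < s < 1 ->
  0 <= (-1) ^+ count id a * signed_g1 a s.
Proof.
elim: a s => [|b a IHa] s lab s01; first by rewrite signed_g1_nil // mulr1.
have la : ~~ last false a by case: a lab {IHa}.
pose G t := - ((-1) ^+ count id (b :: a) * signed_g1 (b :: a) t).
have dG t : 0 < t < 1 -> is_derive t (1 : R) G
    ((-1) ^+ b * form b t * ((-1) ^+ count id a * signed_g1 a t)).
  move=> t01; have := is_deriveMl (- (-1) ^+ count id (b :: a)) (is_derive_signed_g1 b a t01).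
  have -> : (fun x => - (-1) ^+ count id (b :: a) * signed_g1 (b :: a) x) = G.
    by apply/funext => x; rewrite mulNr.
  by rewrite mulrNN /= exprD mulrACA.
have Glim : G t @[t --> 1^'-] --> (0 : R).
  rewrite -oppr0 -[X in _ --> - X](mulr0 ((-1) ^+ count id (b :: a))).
  apply: cvgN; apply: cvgM; first exact: cvg_cst.
  by apply: signed_g1_at1; case: (a) lab.
rewrite -oppr_le0 -/(G s) -(cvg_lim _ Glim) //.
apply: limr_ge; first by apply/cvg_ex; exists 0.
near=> t; apply: (@is_derive_ndecr R G _ 0 1 dG) => //.
- move=> r r01; rewrite mulr_ge0 ?IHa // ltW // form_sign //.
- by lra.
- by near: t; apply: nbhs_left_ge; lra.
Unshelve. all: by end_near. Qed.

Lemma nfold_integral0 n : nfold_integral n (fun _ : seq R => 0%E) = 0%E.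
Proof. by elim: n => //= n IHn; rewrite IHn integral0. Qed.

Lemma path_le_last s (t : seq R) : path <=%R s (rcons t 1) -> s <= 1.
Proof.
by elim: t s => [|x t IHt] s /=; [rewrite andbT|move=> /andP[sx /IHt]; exact: le_trans].
Qed.

(** The iterated integral that defines [omega], with lower bound [s] instead of 0.
    The factor [c] absorbs the form of the outer variable, which the inner
    integral sees as a constant. *)
Definition simplex_integral a s c : \bar R := nfold_integral (size a)
  (fun t : seq R => (if path <=%R s (rcons t 1)
                     then c * \prod_(p <- zip a t) form p.1 p.2 else 0)%:E).

(** The outermost integral is computed with the primitive [- c * signed_g1 (b :: a)].
    Its limit at [s] is a value when [0 < s]; when [s = 0], the simplex is the
    whole one and [L] is a coefficient of the associator. *)
Lemma simplex_integral_step (b : bool) a s c L : ~~ last true (b :: a) -> 0 <= s < 1 ->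
  signed_g1 (b :: a) t @[t --> s^'+] --> L ->
  (forall t c', 0 < t < 1 -> simplex_integral a t c' = (c' * signed_g1 a t)%:E) ->
  simplex_integral (b :: a) s c = (c * L)%:E.
Proof.
move=> lab s01 Llim IHa; rewrite /simplex_integral [LHS]/=.
have la : ~~ last false a by case: (a) lab.
have -> : c * L = 0 - - c * L by rewrite mulNr opprK add0r.
pose g t := c * form b t * signed_g1 a t.
apply: (@integral_primitive R _ g (fun t => - c * signed_g1 (b :: a) t) s 1).
- by lra.
- move=> t st1; have t01 : 0 < t < 1 by lra.
  have := is_deriveMl (- c) (is_derive_signed_g1 b a t01).
  by rewrite mulrNN mulrA.
- move=> t st1; have t01 : 0 < t < 1 by lra.
  apply: continuousM; last exact: signed_g1_continuous.
  apply: continuousM; first exact: cvg_cst.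
  have df : derivable (form b) t 1.
    rewrite /form; case: b {lab Llim g la}.
      apply: derivableV; first by rewrite subr_eq0; lra.
      exact: derivableB.
    by apply: derivableV; [lra|exact: derivable_id].
  exact/differentiable_continuous/derivable1_diffP.
- have sgn t : s < t < 1 ->
      0 <= (-1) ^+ b * form b t * ((-1) ^+ count id a * signed_g1 a t).
    by move=> st1; rewrite mulr_ge0 ?signed_g1_sign ?ltW ?form_sign //; lra.
  have [c0|c0] := leP 0 c.
    exists (b + count id a)%N => t /sgn; rewrite exprD mulrACA => H.
    by rewrite /g -[c * _ * _]mulrA mulrCA mulr_ge0.
  exists (b + count id a).+1 => t /sgn; rewrite exprS exprD mulrACA => H.
  by rewrite /g -[c * _ * _]mulrA mulrCA mulN1r mulNr mulrN -mulNr mulr_ge0 // oppr_ge0 ltW.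
- by apply: cvgM => //; exact: cvg_cst.
- rewrite -[X in _ --> X](mulr0 (- c)); apply: cvgM; first exact: cvg_cst.
  exact: signed_g1_at1.
- move=> t st1; rewrite /g -IHa; last by lra.
  rewrite /simplex_integral; congr nfold_integral; apply/funext => ts /=.
  have -> /= : s <= t by lra.
  by rewrite big_cons /= mulrA.
- move=> t ts; rewrite -[RHS](nfold_integral0 (size a)); congr nfold_integral.
  by apply/funext => r; rewrite /= leNgt ts.
move=> t t1; rewrite -[RHS](nfold_integral0 (size a)); congr nfold_integral.
apply/funext => r /=; case: ifP => // /andP[_ /path_le_last].
by rewrite leNgt t1.
Qed.

Lemma simplex_integralE a s c : ~~ last false a -> 0 < s < 1 ->
  simplex_integral a s c = (c * signed_g1 a s)%:E.
Proof.
elim: a s c => [|b a IHa] s c la s01.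
  rewrite /simplex_integral /= andbT big_nil mulr1 signed_g1_nil // mulr1.
  by have -> : s <= 1 by lra.
apply: simplex_integral_step => //.
- by lra.
- exact/cvg_at_right_filter/signed_g1_continuous.
by move=> t c' t01; apply: IHa => //; case: (a) la.
Qed.

Lemma g1_g0_cvg0 u v :
  g1 s u * g0 s (rcons v true) @[s --> 0^'+] --> (0 : R).
Proof.
have [C0 vC] := g0_rcons_true v.
pose C1 := Num.max C0 1; have C1_gt0 : 0 < C1 by rewrite lt_max ltr01 orbT.
apply/cvgr0Pnorm_lt => e e0.
have h0 : 0 < e / (2 * C1) by rewrite divr_gt0 // mulr_gt0.
have [C uC] := g1_growth u h0.
pose C2 := Num.max C 1; have C2_gt0 : 0 < C2 by rewrite lt_max ltr01 orbT.
near=> s.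
have s2 : 0 < s < 2^-1.
  apply/andP; split; near: s; first exact: nbhs_right_gt.
  by apply: nbhs_right_lt; lra.
have s0 : 0 < s by lra.
have sd : s < e / (2 * (C2 * C1)).
  by near: s; apply: nbhs_right_lt; rewrite divr_gt0 // !mulr_gt0.
rewrite normrM.
have b1 : `|g1 s u| <= C2 + e / (2 * C1) * s^-1.
  by apply: (le_trans (uC s s2)); rewrite lerD2r le_max lexx.
have b0 : `|g0 s (rcons v true)| <= C1 * s.
  by apply: (le_trans (vC s s2)); rewrite ler_pM2r // le_max lexx.
apply: (le_lt_trans (ler_pM _ _ b1 b0)) => //.
have -> : (C2 + e / (2 * C1) * s^-1) * (C1 * s) = C2 * C1 * s + e / 2.
  by field; rewrite !gt_eqF.
have : C2 * C1 * s < e / 2.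
  by move: sd; rewrite invfM mulrA ltr_pdivlMr ?mulr_gt0 // mulrC.
by lra.
Unshelve. all: by end_near. Qed.

(** In the coefficient of antipode (g1 s) * g0 s at [w], all terms but the last one
    contain a coefficient of [g0 s] at a word that ends with A_1, and tend to
    0. *)
Lemma signed_g1_at0 a :
  signed_g1 (true :: a) s @[s --> 0^'+] --> real_associator g0 g1 (rev (true :: a)).
Proof.
set w := rev (true :: a).
pose err s := \sum_(k < size w) antipode (g1 s) (take k w) * g0 s (drop k w).
have E s : 0 < s < 1 -> signed_g1 (true :: a) s = real_associator g0 g1 w - err s.
  move=> s01; rewrite -(quotientE s01) nccoefM big_ord_recr /= take_size drop_size.
  rewrite (grouplike_g0 g01 s01).1 mulr1 /err [X in X - _]addrC addrK.
  by rewrite /signed_g1 /w size_rev revK.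
have errlim : err s @[s --> 0^'+] --> (0 : R).
  have sum0 : \sum_(k < size w) (0 : R) = 0 by rewrite big1.
  rewrite -[X in _ --> X]sum0.
  apply: (@cvg_bigsum R _ _ _ _ _ (fun (k : 'I_(size w)) s =>
    antipode (g1 s) (take k w) * g0 s (drop k w))) => k.
  have dE : drop k w = rcons (drop k (rev a)) true.
    have wE : w = rcons (rev a) true by rewrite /w rev_cons.
    rewrite [X in drop _ X]wE drop_rcons //.
    by rewrite -ltnS -(size_rcons _ true) -wE ltn_ord.
  have lim : (-1) ^+ size (take k w) *
      (g1 s (rev (take k w)) * g0 s (rcons (drop k (rev a)) true)) @[s --> 0^'+] -->
      (-1) ^+ size (take k w) * (0 : R).
    by apply: cvgM; [exact: cvg_cst|exact: g1_g0_cvg0].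
  rewrite mulr0 in lim; rewrite dE /=; under eq_fun do rewrite -mulrA.
  exact: lim.
have : real_associator g0 g1 w - err s @[s --> 0^'+] --> real_associator g0 g1 w - 0.
  by apply: cvgB => //; exact: cvg_cst.
rewrite subr0; apply: cvg_trans; apply: near_eq_cvg.
by apply: filterS (@at_right0_01 R) => s; rewrite /= in_itv /= => /E ->.
Qed.

Lemma omega_real_associator a : admissible a -> omega R a = real_associator g0 g1 (rev a).
Proof.
case: a => [|b a] /andP[] //= /eqP-> /eqP la.
have la' : ~~ last true (true :: a) by case: a la => //= ? ? ->.
have := @simplex_integral_step true a 0 1 _ la' _ (@signed_g1_at0 a) _.
rewrite mul1r => /(_ _ _) H.
rewrite /omega; have -> : nfold_integral (size (true :: a)) (fun t : seq R =>
    (if path <=%R 0 (rcons t 1)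
     then \prod_(p <- zip (true :: a) t) form p.1 p.2 else 0)%:E) =
    simplex_integral (true :: a) 0 1.
  by rewrite /simplex_integral; congr nfold_integral; apply/funext => t; rewrite mul1r.
rewrite H //; first by rewrite lexx ltr01.
by move=> t c' t01; apply: simplex_integralE => //; case: a la {H la'} => //= ? ? ->.
Qed.

End Limits.

Lemma tnth_rev_ord n (T : Type) (i : n.-tuple T) (k : 'I_n) :
  tnth i (rev_ord k) = tnth (rev_tuple i) k.
Proof.
case: n i k => [i []//|n] i k; have x := tnth i k.
by rewrite !(tnth_nth x) /= nth_rev size_tuple.
Qed.

Theorem corollary1 (R : realType) (Phi : ncseries bool R[i]) :
  is_KZ_associator Phi ->
  ncseries_cvg
    (fun N : nat =>
       \sum_(1 <= n < N)
         \sum_(a : n.-tuple bool | admissible a) \sum_(i : n.-tuple bool)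
           ((omega R a)%:C * (C_coef a i)%:~R) *:
             CBH_eval (fun k : 'I_n =>
               ncvar (tnth i (rev_ord k)) : ncseries bool R[i]))
    (nclog Phi).
Proof.
move=> /KZ_associator_real[g0 [g1 [g01 PhiE]]].
have PhiC : Phi = ncseriesC (real_associator g0 g1).
  by rewrite (PhiE _ (half_in01 R)) (ncseriesC_quotient g01 (half_in01 R)).
have quotientE z : 0 < z < 1 -> antipode (g1 z) * g0 z = real_associator g0 g1.
  move=> z01; apply: (@ncseriesC_inj R).
  by rewrite -PhiC -(ncseriesC_quotient g01 z01) -PhiE.
have GPhi : grouplike Phi.
  by rewrite PhiC; apply: grouplike_ncseriesC; apply: grouplike_real_associator.
have Phi_letter x : Phi [:: x] = 0 by rewrite PhiC ncseriesCE (real_associator_letter g01).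
have Phi_omega n (a : n.-tuple bool) : admissible a -> (omega R a)%:C = Phi (rev a).
  by move=> adm; rewrite PhiC ncseriesCE (omega_real_associator g01 quotientE adm).
move=> d; exists d => N le_dN w lt_wd; rewrite nccoef_sum.
pose CBHu n (u : n.-tuple bool) := CBH_eval (fun k : 'I_n =>
  ncvar (tnth u k) : ncseries bool R[i]).
have termE n : (\sum_(a : n.-tuple bool | admissible a) \sum_(i : n.-tuple bool)
    ((omega R a)%:C * (C_coef a i)%:~R) *: CBH_eval (fun k : 'I_n =>
       ncvar (tnth i (rev_ord k)) : ncseries bool R[i])) w =
    \sum_(a : n.-tuple bool | admissible a) \sum_(u : n.-tuple bool)
      (Phi (rev a) * (C_generating a u)%:~R) * CBHu n u w.
  rewrite nccoef_sum; apply: eq_bigr => a adm; rewrite nccoef_sum.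
  rewrite [RHS](reindex_inj (_ : injective (fun t : n.-tuple bool => rev_tuple t))).
    apply: eq_bigr => i _; rewrite nccoefZ (Phi_omega n a adm); congr (_ * _).
    by rewrite /CBHu; congr (nccoef (CBH_eval _) w); apply/funext => k; rewrite tnth_rev_ord.
  by move=> s t /(congr1 val) /= /(can_inj revK) ?; apply: val_inj.
under eq_bigr do rewrite termE.
have other n : size w != n -> \sum_(a : n.-tuple bool | admissible a)
    \sum_(u : n.-tuple bool)
      (Phi (rev a) * (C_generating a u)%:~R) * CBHu n u w = 0.
  move=> wn; rewrite big1 // => a _; rewrite big1 // => u _.
  by rewrite /CBHu CBH_eval_homog // mulr0.
have [w0|w_gt0] := posnP (size w).
  rewrite big_nat big1 => [|n /andP[n_gt0 _]]; last first.
    by apply: other; rewrite w0 eq_sym -lt0n.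
  by rewrite /= w0 big_geq.
rewrite (bigD1_seq (size w)) ?iota_uniq //=; last first.
  by rewrite mem_index_iota w_gt0 (leq_trans lt_wd).
rewrite [X in _ + X]big1 ?addr0 => [|n ne]; last by apply: other; rewrite eq_sym.
apply: etrans (esym (nclog_grouplike (in_tuple w) GPhi)).
rewrite exchange_big /=.
apply: eq_bigr => u _; rewrite -mulr_suml; congr (_ * _).
exact: (admissible_expansion GPhi (Phi_letter true) (Phi_letter false)
  (size_tuple u) w_gt0).
Qed.
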